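(* Let $p\ge 3$ be a prime and $k$ a positive integer with $p\nmid k$, and let $\phi_{(p,k)}(x)=x^p+kpx^{p-1}-kp\in\mathbb{Z}[x]$. If $p\ge 5$ and $k\equiv 1 \pmod 3$, then $G_{\mathbb{Q}}(\phi_{(p,k)})=\mathrm{Aut}(T_\infty)$. Moreover, $G_{\mathbb{Q}}(\phi_{(3,2)})=\mathrm{Aut}(T_\infty)$, where $\phi_{(3,2)}(x)=x^3+6x^2-6$. Consequently, for every prime $\ell$ there exists a polynomial $\varphi\in\mathbb{Z}[x]$ of degree $\ell$ with $G_{\mathbb{Q}}(\varphi)=\mathrm{Aut}(T_\infty)$.
   Context: For a number field $K$ and $\varphi\in K[x]$ of degree $d\ge 2$ such that every iterate $\varphi^n$ ($n\ge1$, $\varphi^n$ the $n$-fold composition) is separable, the pre-image tree $T_\infty$ has vertex set $\bigsqcup_{n\ge 0}\varphi^{-n}(0)$ (with $\varphi^{-0}(0)=\{0\}$), and $\alpha\in\varphi^{-n}(0)$, $\beta\in\varphi^{-(n+1)}(0)$ are joined by an edge iff $\varphi(\beta)=\alpha$. $\mathrm{Aut}(T_\infty)$ is its graph automorphism group (isomorphic to the infinite iterated wreath product of $S_d$). The absolute Galois group $\mathrm{Gal}(\overline{K}/K)$ acts on $T_\infty$ through its action on the sets $\varphi^{-n}(0)$, giving a homomorphism $\rho:\mathrm{Gal}(\overline K/K)\to\mathrm{Aut}(T_\infty)$; $G_K(\varphi)$ denotes its image. *)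

(* Defs.v *)
From HB Require Import structures.
From mathcomp Require Import all_boot all_order all_algebra.
From mathcomp Require Import separable algC.
Set Implicit Arguments. Unset Strict Implicit. Unset Printing Implicit Defensive.
Import GRing.Theory Num.Theory.
Local Open Scope ring_scope.

(* algC (algebraic complex numbers) plays the role of an algebraic closure
   of Q; Gal(Qbar/Q) = bijective ring endomorphisms of algC. *)

Definition iter_poly (phi : {poly int}) (n : nat) : {poly int} :=
  iter n (fun q => phi \Po q) 'X.

Definition qbar (phi : {poly int}) : {poly algC} := map_poly intr phi.

(* vertices of T_infty: pairs (n, a) with a a root of phi^n (disjoint union) *)
Definition tree_vertex (phi : {poly int}) :=
  {v : nat * algC | root (qbar (iter_poly phi v.1)) v.2}.

Definition tree_adj (phi : {poly int}) (u v : tree_vertex phi) : Prop :=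
  ((val v).1 = (val u).1.+1 /\ (qbar phi).[(val v).2] = (val u).2) \/
  ((val u).1 = (val v).1.+1 /\ (qbar phi).[(val u).2] = (val v).2).

Definition tree_aut (phi : {poly int}) (f : tree_vertex phi -> tree_vertex phi) : Prop :=
  bijective f /\ forall u v, tree_adj u v <-> tree_adj (f u) (f v).

(* f lies in G_Q(phi), the image of rho : Gal(Qbar/Q) -> Aut(T_infty) *)
Definition gal_image (phi : {poly int}) (f : tree_vertex phi -> tree_vertex phi) : Prop :=
  exists2 s : {rmorphism algC -> algC}, bijective s &
    forall v, val (f v) = ((val v).1, s (val v).2).

Definition full_arboreal (phi : {poly int}) : Prop :=
  (forall n, separable_poly (qbar (iter_poly phi n.+1))) /\
  (forall f : tree_vertex phi -> tree_vertex phi, gal_image f <-> tree_aut f).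

Definition phi_pk (p k : nat) : {poly int} :=
  ('X^p + (((k * p)%N)%:R : int)%:P * 'X^(p.-1) - (((k * p)%N)%:R : int)%:P)%R.

(* Main.v *)
From HB Require Import structures.
From mathcomp Require Import boolp classical_sets filter.
Require Import Defs.
From mathcomp Require Import all_boot all_order all_algebra.
From mathcomp Require Import fingroup perm action all_field.
From mathcomp Require Import ring zify.
Set Implicit Arguments. Unset Strict Implicit. Unset Printing Implicit Defensive.
Import Order.TTheory GRing.Theory Num.Theory.
Local Open Scope ring_scope.

(* phi = phi_(p,k) has the critical points 0 and c = -k(p-1), and 0 -> -kp -> -kp.  Modulo
   a prime q dividing phi^n(c) but not kp, the orbit of 0 never vanishes, so c is a double
   root of phi^n, all other roots are simple, and the discriminant of phi^n has the same
   q-adic valuation as phi^n(c).  Now phi^n(c)/k is prime to kp and not a square up to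
   sign, by a congruence modulo 3, modulo 8 for (p, k) = (3, 2), and modulo 4 for
   (p, k) = (2, 3), which settles degree 2.  Hence some such q divides the discriminant to
   an odd power, and an inertia element at q transposes two roots of phi^n and fixes all
   the others.  As phi^n is Eisenstein at p, the Galois group is transitive on its roots,
   so "being exchanged by a Galois transposition" cuts the fibers of phi, which have p
   elements, into classes of one common size at least 2.  That size divides p, so all
   fiberwise permutations occur, and a tree automorphism is realized level by level.

   The inertia element is obtained without ramification theory, from a residue field of
   characteristic q of the ring of all algebraic integers.  If d^2 = D is an integer of
   odd valuation at q and t(d) = -d, then the reductions of a and t(a) agree for every a
   fixed by the stabiliser H of d; and two morphisms to a field that agree on the
   invariants of H differ by an element of H on any finite H-stable set. *)

(** * Permutations preserving the fibers of a map *)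

Section FiberwisePermutations.
Variables (T : finType) (B : eqType) (F : T -> B) (G : {group {perm T}}).

Lemma fiberwise_perm_in_group (g : {perm T}) :
  (forall x y, F x = F y -> tperm x y \in G) -> (forall x, F (g x) = F x) -> g \in G.
Proof.
move=> tpermG; have [m] := ubnP #|[set x | g x != x]|.
elim: m g => // m IHm g; rewrite ltnS => le_gm Fg.
have [/forallP g_id|] := boolP [forall a, g a == a].
  suff -> : g = 1%g by exact: group1.
  by apply/permP => x; rewrite perm1; apply/eqP/g_id.
rewrite negb_forall => /existsP[a ga].
have tG : tperm a (g a) \in G by apply/tpermG/esym.
have -> : g = (g * tperm a (g a) * tperm a (g a))%g by rewrite -mulgA tperm2 mulg1.
apply: groupM tG; apply: IHm => [|x]; last first.
  by rewrite permM; case: tpermP => [gx|/perm_inj <-|_ _]; rewrite // Fg // -gx Fg.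
apply: leq_trans le_gm; apply: proper_card; apply/properP; split; last first.
  by exists a; rewrite inE // permM tpermR eqxx.
apply/subsetP => x; rewrite !inE permM; apply: contraNneq => gx; rewrite gx tpermD //.
  by apply: contraNneq ga => ->; rewrite gx.
by apply: contraNneq ga => gax; rewrite -(inj_eq (@perm_inj _ g)) gax gx.
Qed.

Hypotheses (F_compat : forall g x y, g \in G -> F x = F y -> F (g x) = F (g y))
  (G_trans : [transitive G, on [set: T] | 'P]).

Definition tperm_class x := [set y | (F y == F x) && (tperm x y \in G)].

Lemma mem_tperm_class x : x \in tperm_class x.
Proof. by rewrite inE eqxx tperm1 group1. Qed.

Lemma tperm_class_eq x y : y \in tperm_class x -> tperm_class y = tperm_class x.
Proof.
rewrite inE => /andP[/eqP Fyx xyG]; apply/setP => z; rewrite !inE Fyx.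
have [->|zx] := eqVneq z x; first by rewrite tperm1 group1 tpermC xyG.
have [->|zy] := eqVneq z y; first by rewrite tperm1 group1 xyG.
congr (_ && _); have -> : tperm y z = (tperm x z ^ tperm x y)%g.
  by rewrite tpermJ tpermL tpermD // eq_sym.
by rewrite groupJr.
Qed.

Lemma card_tperm_class x y : #|tperm_class x| = #|tperm_class y|.
Proof.
suff le_card u v : (#|tperm_class u| <= #|tperm_class v|)%N.
  by apply/eqP; rewrite eqn_leq !le_card.
have [g gG ->] := atransP2 G_trans (in_setT u) (in_setT v); rewrite /= /aperm.
rewrite -(card_imset _ (@perm_inj _ g)); apply: subset_leq_card.
apply/subsetP => _ /imsetP[z + ->]; rewrite !inE => /andP[/eqP Fzu uzG].
by rewrite -tpermJ groupJ // andbT; apply/eqP/F_compat.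
Qed.

Lemma tperm_class_partition x :
  partition [set tperm_class y | y in [set y | F y == F x]] [set y | F y == F x].
Proof.
apply/and3P; split.
- apply/eqP/setP => z; rewrite /cover inE; apply/bigcupP/idP => [[_ /imsetP[y + ->]]|Fz].
    by rewrite !inE => /eqP <- /andP[].
  by exists (tperm_class z); rewrite ?mem_tperm_class //; apply/imset_f; rewrite inE.
- apply/trivIsetP => _ _ /imsetP[y _ ->] /imsetP[z _ ->]; apply: contraNT.
  by case/pred0Pn => w /andP[/tperm_class_eq <- /tperm_class_eq <-].
- by apply/imsetP => -[y _ /setP/(_ y)]; rewrite mem_tperm_class inE.
Qed.

Lemma transposition_in_fiber a b :
  (forall x, exists2 y, y != x & F y = F x) -> a != b -> tperm a b \in G -> F a = F b.
Proof.
move=> /(_ a)[y ya Fya] ab abG; have [<-//|yb] := eqVneq y b.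
by have := F_compat abG Fya; rewrite tpermL tpermD ?[_ == y]eq_sym // => <-.
Qed.

Theorem fiberwise_perm_of_transposition (p : nat) (a b : T) (g : {perm T}) :
  prime p -> (forall x, #|[set y | F y == F x]| = p) ->
  a != b -> tperm a b \in G -> (forall x, F (g x) = F x) -> g \in G.
Proof.
move=> p_pr card_fiber ab abG; apply: fiberwise_perm_in_group => x y Fxy.
have Fab : F a = F b.
  apply: transposition_in_fiber ab abG => z.
  have : (1 < #|[set y | F y == F z]|)%N by rewrite card_fiber prime_gt1.
  rewrite (cardsD1 z) inE eqxx ltnS card_gt0 => /set0Pn[u].
  by rewrite !inE => /andP[uz /eqP Fuz]; exists u.
have card_dvd : (#|tperm_class x| %| p)%N.
  rewrite -(card_fiber x).
  rewrite (card_uniform_partition (n := #|tperm_class x|) _ (tperm_class_partition x)).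
    exact: dvdn_mull.
  by move=> _ /imsetP[z _ ->]; apply: card_tperm_class.
have card_gt1 : (1 < #|tperm_class x|)%N.
  have <- : #|[set a; b]| = 2%N by rewrite cards2 ab.
  rewrite (card_tperm_class x a); apply: subset_leq_card.
  by rewrite subUset !sub1set mem_tperm_class inE Fab eqxx abG.
have /eqP : tperm_class x == [set y | F y == F x].
  rewrite eqEcard card_fiber (prime_nt_dvdP p_pr _ card_dvd) ?gtn_eqF // leqnn andbT.
  by apply/subsetP => z; rewrite !inE => /andP[].
by move/setP/(_ y); rewrite !inE Fxy eqxx => /andP[].
Qed.

End FiberwisePermutations.

(** * Automorphisms of the algebraic numbers *)

Lemma perm_map_stable (T : eqType) (s : T -> T) (l : seq T) :
  injective s -> uniq l -> {in l, forall z, s z \in l} -> perm_eq (map s l) l.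
Proof.
move=> s_inj l_uniq l_stable.
have sl_uniq : uniq (map s l) by rewrite map_inj_uniq.
have sub : {subset map s l <= l} by move=> _ /mapP[z lz ->]; apply: l_stable.
by apply: uniq_perm => //; have [] := uniq_min_size sl_uniq sub; rewrite ?size_map.
Qed.

Lemma Crat_fixed_splitting (L : splittingFieldType rat)
    (LC : {rmorphism L -> algC}) (x : L) :
  (forall s : {rmorphism algC -> algC}, s (LC x) = LC x) -> LC x \in Crat.
Proof.
move=> fix_x; have galL : galois 1 {:L}.
  apply/and3P; split; [exact: sub1v | | exact: normalFieldf].
  apply/separableP => y _; apply: pcharf0_separable => q.
  by rewrite pchar_lalg pchar_num.
have : x \in (1%AS : {subfield L}).
  have/galois_fixedField <- := galL; apply/fixedFieldP; first exact: memvf.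
  move=> g _; have [nu Dnu] := extend_algC_subfield_aut LC (g : 'AEnd(L)).
  by apply: (fmorph_inj LC); rewrite Dnu.
by move=> /vlineP[a ->]; rewrite rmorphZ_num rmorph1 mulr1 Crat_rat.
Qed.

Lemma splitting_num_field_exists (p : {poly rat}) (r : seq algC) :
  map_poly ratr p = \prod_(z <- r) ('X - z%:P) ->
  exists (L : splittingFieldType rat) (LC : {rmorphism L -> algC}),
    {in r, forall z, exists x, LC x = z}.
Proof.
move=> Dp; have [Qr [QrC [rr Drr genQr]]] := num_field_exists r.
have splitQr : SplittingField.axiom Qr.
  exists (map_poly (in_alg Qr) p).
    by apply/polyOverP=> i; rewrite coef_map memvZ ?memv_line.
  exists rr => //; congr (_ %= _): (eqpxx (map_poly (in_alg Qr) p)).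
  apply/(map_poly_inj QrC); rewrite -map_poly_comp.
  rewrite (@eq_map_poly _ _ _ ratr) => [|a]; last first.
    by rewrite /= rmorphZ_num rmorph1 mulr1.
  by rewrite Dp -Drr big_map map_prod_XsubC.
pose L : splittingFieldType rat :=
  HB.pack Qr (FieldExt_isSplittingField.Build rat Qr splitQr).
by exists L, QrC => z; rewrite -Drr => /mapP[x _ ->]; exists x.
Qed.

Lemma Crat_fixed (x : algC) :
  (forall s : {rmorphism algC -> algC}, s x = x) -> x \in Crat.
Proof.
move=> fix_x; have [p [Dp mon_p] dv_p] := minCpolyP x.
have [r] := closed_field_poly_normal (map_poly (ratr : rat -> algC) p).
rewrite lead_coef_map (monicP mon_p) rmorph1 scale1r => Dr.
have rx : x \in r by rewrite -root_prod_XsubC -Dr dv_p.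
have [L [LC /(_ x rx)[y Dy]]] := splitting_num_field_exists Dr.
by rewrite -Dy; apply: Crat_fixed_splitting => s; rewrite Dy.
Qed.

Definition poly_roots (f : {poly algC}) : seq algC := sval (closed_field_poly_normal f).

Lemma poly_rootsE (f : {poly algC}) : f \is monic ->
  f = \prod_(z <- poly_roots f) ('X - z%:P).
Proof.
move=> f_mon; have := svalP (closed_field_poly_normal f).
by rewrite -/(poly_roots f) (monicP f_mon) scale1r.
Qed.

Lemma mem_poly_roots (f : {poly algC}) z : f \is monic -> (z \in poly_roots f) = root f z.
Proof. by move=> f_mon; rewrite {2}(poly_rootsE f_mon) root_prod_XsubC. Qed.

Lemma size_poly_roots (f : {poly algC}) : f \is monic -> size (poly_roots f) = (size f).-1.
Proof. by move=> f_mon; rewrite {2}(poly_rootsE f_mon) size_prod_XsubC. Qed.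

Lemma uniq_poly_roots (f : {poly algC}) :
  f \is monic -> uniq (poly_roots f) = separable_poly f.
Proof. by move=> f_mon; rewrite {2}(poly_rootsE f_mon) separable_prod_XsubC. Qed.

Lemma separable_poly_algCP (f : {poly algC}) :
  reflect (forall x, root f x -> f^`().[x] != 0) (separable_poly f).
Proof. by rewrite unlock; apply: Pdiv.ClosedField.coprimepP. Qed.

Lemma irreducible_poly_separable (F : fieldType) (f : {poly F}) :
  [pchar F] =i pred0 -> irreducible_poly f -> separable_poly f.
Proof.
move=> /pcharf0P pchar0 irr_f; rewrite unlock irreducible_poly_coprime //; apply/negP.
have f_neq0 := irredp_neq0 irr_f; have [n Dn] : exists n, size f = n.+2.
  by case: irr_f => + _; case: (size f) => [|[|n]] // _; exists n.
have df_neq0 : f^`() != 0.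
  apply/eqP => /polyP/(_ n)/eqP; rewrite coef_deriv coef0 -mulr_natr mulf_eq0 pchar0 orbF.
  by rewrite -[n.+1]/(n.+2.-1) -Dn -lead_coefE lead_coef_eq0 (negPf f_neq0).
by move/(dvdp_leq df_neq0); rewrite leqNgt lt_size_deriv.
Qed.

Lemma Crat_poly_fixed (g : {poly algC}) :
  (forall s : {rmorphism algC -> algC}, map_poly s g = g) ->
  exists h : {poly rat}, g = map_poly ratr h.
Proof.
move=> fix_g; exists (\poly_(i < size g) getCrat g`_i); apply/polyP => i.
rewrite coef_map coef_poly /=.
case: ltnP => [_|/(nth_default 0) ->]; last by rewrite rmorph0.
rewrite getCratK //; apply: Crat_fixed => s.
by have /polyP/(_ i) := fix_g s; rewrite coef_map.
Qed.

Lemma irreducible_poly_conj (f : {poly rat}) (a b : algC) : irreducible_poly f ->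
  root (map_poly ratr f) a -> root (map_poly ratr f) b ->
  exists s : {rmorphism algC -> algC}, s a = b.
Proof.
move=> irr_f fa fb; have [r Dr] := closed_field_poly_normal (minCpoly a).
pose conj_a := [pred z | `[< exists s : {rmorphism algC -> algC}, s a = z >]].
pose orb := undup [seq z <- r | conj_a z].
have mem_orb z : (z \in orb) = conj_a z.
  rewrite mem_undup mem_filter andb_idr // => /asboolP[s <-].
  have : root (minCpoly a) (s a) by rewrite -(minCpoly_aut s) root_minCpoly.
  by rewrite Dr rootZ ?lead_coef_eq0 ?monic_neq0 ?minCpoly_monic // root_prod_XsubC.
have [s|g Dg] := @Crat_poly_fixed (\prod_(z <- orb) ('X - z%:P)).
  rewrite map_prod_XsubC.
  rewrite -[RHS](perm_big _ (perm_map_stable (fmorph_inj s) (undup_uniq _) _)).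
    by rewrite big_map.
  by move=> z; rewrite !mem_orb => /asboolP[t <-]; apply/asboolP; exists (s \o t)%FUN.
have ga : root (map_poly ratr g) a.
  by rewrite -Dg root_prod_XsubC mem_orb; apply/asboolP; exists idfun.
have f_dvd_g : f %| g.
  rewrite -[_ %| _]negbK -irreducible_poly_coprime //; apply/negP.
  rewrite -(coprimep_map (ratr : {rmorphism rat -> algC})) => /coprimep_root/(_ fa).
  by move/negP; apply.
have : root (map_poly ratr g) b by apply: root_dvdp fb; rewrite dvdp_map.
by rewrite -Dg root_prod_XsubC mem_orb => /asboolP.
Qed.

(* Each orbit is finite, so the values along an ultrafilter stabilise. *)
Lemma aut_limit (s_ : nat -> {rmorphism algC -> algC}) :
  exists s : {rmorphism algC -> algC}, forall x y : algC,
    (\forall m \near eventually, s_ m x = y) -> s x = y.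
Proof.
have [U [UU leU]] := @ultraFilterLemma nat eventually _.
have lim x : exists y, U [set m | s_ m x = y]%classic.
  have [r Dr] := closed_field_poly_normal (minCpoly x).
  rewrite (monicP (minCpoly_monic x)) scale1r in Dr.
  have : U [set m | s_ m x \in r]%classic.
    apply: filterS filterT => m _ /=.
    by rewrite -root_prod_XsubC -Dr -(minCpoly_aut (s_ m)) root_minCpoly.
  elim: r {Dr} => [|y r IHr] Ur.
    by have [m] := filter_ex Ur; rewrite /= in_nil.
  have [Uy|Uy] := in_ultra_setVsetC [set m | s_ m x = y]%classic UU; first by exists y.
  apply: IHr; apply: filterS (filterI Ur Uy) => m [/= + /eqP/negPf].
  by rewrite inE => /orP[->|].
have [s Ds] := choice lim.
have uniqU x y : U [set m | s_ m x = y]%classic -> s x = y.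
  by move=> Uxy; have [m [/= <- <-]] := filter_ex (filterI Uxy (Ds x)).
have sB : zmod_morphism s.
  move=> x y; apply: uniqU; apply: filterS (filterI (Ds x) (Ds y)) => m [/= <- <-].
  exact: rmorphB.
have sM : monoid_morphism s.
  split=> [|x y]; apply: uniqU.
    by apply: filterS filterT => m _; apply: rmorph1.
  by apply: filterS (filterI (Ds x) (Ds y)) => m [/= <- <-]; apply: rmorphM.
pose sR : {rmorphism algC -> algC} := HB.pack s
  (GRing.isZmodMorphism.Build _ _ s sB) (GRing.isMonoidMorphism.Build _ _ s sM).
by exists sR => x y /leU; apply: uniqU.
Qed.

(** * Residue fields of the ring of algebraic integers *)

Section MaximalIdeals.
Variable R : comNzRingType.
Implicit Types (A B I : set R) (x u : R).

Definition is_proper_ideal A :=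
  [/\ A 0, ~ A 1 & forall a u v, A u -> A v -> A (a * u + v)].

Definition is_maximal_ideal A :=
  is_proper_ideal A /\ forall B, is_proper_ideal B -> (A `<=` B -> B `<=` A)%classic.

Lemma principal_proper_ideal x : (forall y, y * x <> 1) ->
  is_proper_ideal (fun u => exists y, u = y * x).
Proof.
move=> x_nonunit; split=> [|[y /esym/x_nonunit]//|a _ _ [b ->] [c ->]].
  by exists 0; rewrite mul0r.
by exists (a * b + c); rewrite mulrDl mulrA.
Qed.

Lemma maximal_ideal_exists I : is_proper_ideal I ->
  exists2 A, (I `<=` A)%classic & is_maximal_ideal A.
Proof.
move=> I_ideal; pose good A := (I `<=` A)%classic /\ is_proper_ideal A.
have [|A [goodA maxA]] := @Zorn_bigcup R (fun A => (exists u, A u) -> good A).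
  move=> F Fgood Ftot [y [X FX Xy]].
  have goodF Y u (FY : F Y) (Yu : Y u) : good Y by apply: (Fgood _ FY); exists u.
  have [IX [X0 _ _]] := goodF _ _ FX Xy; split; first by move=> u /IX; exists X.
  split=> [|[Y FY Y1]|a u v [Y FY Yu] [Z FZ Zv]]; first by exists X.
    by have [_ [_ nY1 _]] := goodF _ _ FY Y1.
  have [_ [_ _ YM]] := goodF _ _ FY Yu; have [_ [_ _ ZM]] := goodF _ _ FZ Zv.
  by case: (Ftot _ _ FY FZ) => sub; [exists Z | exists Y] => //;
    [apply: ZM => //; apply: sub | apply: YM => //; apply: sub].
have {goodA}[IA A_ideal] : good A.
  apply: goodA; apply: contrapT => /forallNP noA; apply: (maxA I) => [|_]; last by split.
  by split=> [u /noA//|/(_ 0) IA]; apply/(noA 0)/IA; case: I_ideal.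
exists A => //; split=> // B B_ideal AB; apply: contrapT => nBA.
by apply: (maxA B) => // _; split=> // u /IA/AB.
Qed.

Lemma maximal_ideal_inverse A u : is_maximal_ideal A -> ~ A u ->
  exists b, A (1 - b * u).
Proof.
move=> [[A0 A1 AM] maxA] nAu; apply: contrapT => /forallNP no_b.
pose B : set R := fun w => exists a b, A a /\ w = a + b * u.
have B_ideal : is_proper_ideal B.
  split=> [|[a [b [Aa Dab]]]|c _ _ [a [b [Aa ->]]] [a' [b' [Aa' ->]]]].
  - by exists 0, 0; rewrite mul0r addr0.
  - by apply: (no_b b); rewrite Dab addrK.
  - by exists (c * a + a'), (c * b + b'); split; [exact: AM | ring].
apply: nAu; apply: (maxA B B_ideal) => [a Aa|].
  by exists a, 0; rewrite mul0r addr0.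
by exists 0, 1; rewrite add0r mul1r.
Qed.

Lemma residue_field_exists A : is_maximal_ideal A ->
  exists (K : fieldType) (red : {rmorphism R -> K}), forall u, red u = 0 <-> A u.
Proof.
move=> A_max; have [[A0 A1 AM] _] := A_max.
pose I : {pred R} := [pred u | `[< A u >]].
have I_closed : idealr_closed I.
  split; [exact/asboolP | exact/asboolP |].
  by move=> a u v /asboolP Au /asboolP Av; apply/asboolP/AM.
pose J : idealr R := HB.pack I (isIdealr.Build R I I_closed).
pose Q : comNzRingType := {ideal_quot J}.
pose red : {rmorphism R -> Q} := \pi_{ideal_quot J}%qT.
have red_eq0 u : red u = 0 <-> A u.
  rewrite -(rmorph0 red) (rwP eqP) -[_ == _]/(u == 0 %[mod {ideal_quot J}])%qT.
  by rewrite -Quotient.idealrBE subr0; split=> /asboolP.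
have has_inv (y : Q) : exists z : Q, (y != 0 -> z * y = 1) /\ (y = 0 -> z = 0).
  have [->|] := eqVneq y 0; first by exists 0.
  elim/quotW: y => u; rewrite -/(red u) => /eqP red_u.
  have [|b Ab] := maximal_ideal_inverse (u := u) A_max; first by move/red_eq0.
  exists (red b); split=> // _; apply/esym/eqP; rewrite -subr_eq0 -rmorphM.
  by rewrite -(rmorph1 red) -rmorphB; apply/eqP/red_eq0.
have [inv invP] := choice has_inv.
pose K : fieldType := HB.pack Q
  (GRing.ComNzRing_isField.Build Q (fun y => (invP y).1) ((invP 0).2 erefl)).
by exists K, red.
Qed.

Lemma nonunit_residue_field x : (forall y, y * x <> 1) ->
  exists (K : fieldType) (red : {rmorphism R -> K}), red x = 0.
Proof.
move=> /principal_proper_ideal/maximal_ideal_exists[A xA /residue_field_exists].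
by move=> [K [red red_eq0]]; exists K, red; apply/red_eq0/xA; exists 1; rewrite mul1r.
Qed.

End MaximalIdeals.

Record algInt := AlgInt {algInt_val : algC; algInt_valP : algInt_val \in Aint}.

HB.instance Definition _ := [isSub for algInt_val].
HB.instance Definition _ := [Choice of algInt by <:].
HB.instance Definition _ := [SubChoice_isSubComNzRing of algInt by <:].

Definition algInt_aut (s : {rmorphism algC -> algC}) (x : algInt) : algInt :=
  AlgInt (etrans (Aint_aut s (val x)) (valP x)).

Section AlgIntAut.
Variable s : {rmorphism algC -> algC}.

Lemma algInt_aut_is_zmod_morphism : zmod_morphism (algInt_aut s).
Proof. by move=> x y; apply: val_inj; rewrite /= rmorphB. Qed.

Lemma algInt_aut_is_monoid_morphism : monoid_morphism (algInt_aut s).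
Proof. by split=> [|x y]; apply: val_inj; rewrite /= ?rmorph1 ?rmorphM. Qed.

HB.instance Definition _ := GRing.isZmodMorphism.Build algInt algInt (algInt_aut s)
  algInt_aut_is_zmod_morphism.
HB.instance Definition _ := GRing.isMonoidMorphism.Build algInt algInt (algInt_aut s)
  algInt_aut_is_monoid_morphism.

Lemma algInt_aut_inj : injective (algInt_aut s).
Proof. by move=> x y /(congr1 val)/fmorph_inj/val_inj. Qed.

End AlgIntAut.

Lemma algInt_aut_comp (s t : {rmorphism algC -> algC}) x :
  algInt_aut (s \o t)%FUN x = algInt_aut s (algInt_aut t x).
Proof. exact: val_inj. Qed.

Lemma algInt_fixed (x : algInt) :
  (forall s, algInt_aut s x = x) -> exists m : int, x = m%:~R.
Proof.
move=> fix_x; have /intrP[m Dm] : val x \in Num.int.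
  apply: Cint_rat_Aint (valP x); apply: Crat_fixed => s.
  by rewrite -[in RHS](fix_x s).
by exists m; apply: val_inj; rewrite Dm rmorph_int.
Qed.

Lemma algInt_intr_inj : injective (intr : int -> algInt).
Proof. by move=> m n /(congr1 val)/eqP; rewrite !rmorph_int eqr_int => /eqP. Qed.

Lemma algInt_residue_field (q : nat) : prime q ->
  exists (K : fieldType) (red : {rmorphism algInt -> K}), q \in [pchar K].
Proof.
move=> q_pr; have [y yq1|K [red red_q]] := @nonunit_residue_field algInt q%:R; last first.
  by exists K, red; rewrite inE q_pr -(rmorph_nat red) red_q eqxx.
have q_neq0 : q%:R != 0 :> algC by rewrite pnatr_eq0 -lt0n prime_gt0.
have yq1C : val y * q%:R = 1.
  by have := congr1 val yq1; rewrite rmorphM rmorph_nat rmorph1.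
have /intrP[m Dm] : val y \in Num.int.
  apply: Cint_rat_Aint (valP y).
  by rewrite -[val y](mulfK q_neq0) yq1C div1r rpredV rpred_nat.
move: yq1C; rewrite Dm -[q%:R]/(q%:Z%:~R) -intrM -[1]/(1%:~R) => /eqP.
rewrite eqr_int => /eqP/(congr1 absz); rewrite abszM => /eqP.
by rewrite muln_eq1 /= andbC => /andP[/eqP q1]; rewrite q1 in q_pr.
Qed.

(** * Inertia at an odd prime divisor of a square *)

Lemma odd_logn_dvd (q n : nat) : odd (logn q n) -> (q %| n)%N.
Proof. by apply: contraTT => ndvd; rewrite lognE (negPf ndvd) !andbF. Qed.

Lemma odd_logn_square_dvd (q : nat) (m e D : int) : odd (logn q `|D|) -> m != 0 ->
  m ^+ 2 = e * D -> (q %| e)%Z.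
Proof.
move=> D_odd m_neq0 Dm; have : e * D != 0 by rewrite -Dm expf_neq0.
rewrite mulf_eq0 negb_or => /andP[e_neq0 D_neq0].
have : odd (logn q (`|e| * `|D|)) = false by rewrite -abszM -Dm abszX lognX oddM.
rewrite lognM ?absz_gt0 // oddD D_odd addbT => /negbFE; exact: odd_logn_dvd.
Qed.

Section MorphismsAgreeingOnInvariants.
Variables (A : comNzRingType) (H : {rmorphism A -> A} -> Prop) (rs : seq A).
Hypotheses (H_id : H idfun) (H_comp : forall h1 h2, H h1 -> H h2 -> H (h1 \o h2)%FUN).
Hypotheses (H_inj : forall h, H h -> injective h)
  (H_rs : forall h, H h -> {in rs, forall r, h r \in rs}).

Let theta : {poly A} := \poly_(i < size rs) rs`_i.

Lemma orbit_seq_exists : exists orb : seq {poly A},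
  uniq orb /\ forall Q, Q \in orb <-> exists2 h, H h & Q = map_poly h theta.
Proof.
pose cand (w : {ffun 'I_(size rs) -> 'I_(size rs)}) : {poly A} :=
  \poly_(i < size rs) rs`_(odflt 0%N (omap (val \o w) (insub i))).
pose inH Q := `[< exists2 h, H h & Q = map_poly h theta >].
exists (undup [seq Q <- codom cand | inH Q]); split=> [|Q]; first exact: undup_uniq.
rewrite mem_undup mem_filter; split=> [/andP[/asboolP] //|exQ].
apply/andP; split; first exact/asboolP.
case: exQ => h Hh ->.
have lt_index (i : 'I_(size rs)) : (index (h rs`_i)%R rs < size rs)%N.
  by rewrite index_mem H_rs // mem_nth.
apply/codomP; exists [ffun i => Ordinal (lt_index i)]; apply/polyP => i.
rewrite coef_map !coef_poly; case: ltnP => [lt_i|_]; last exact: rmorph0.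
by rewrite insubT /= ffunE /= nth_index // H_rs // mem_nth.
Qed.

(* theta packs rs into a single element.  With F the product of the T - Q over the
   H-conjugates Q of theta, the images of F under f and g coincide; the first vanishes at
   f(theta) and the second is the product of the T - g(Q). *)
Lemma conj_of_eq_on_invariants (K : idomainType) (f g : {rmorphism A -> K}) :
  (forall a, (forall h, H h -> h a = a) -> f a = g a) ->
  exists2 h, H h & {in rs, forall r, f r = g (h r)}.
Proof.
move=> fg; have [orb [orb_uniq orbP]] := orbit_seq_exists.
pose F : {poly {poly A}} := \prod_(Q <- orb) ('X - Q%:P).
have mapF (B : comNzRingType) (h : {rmorphism A -> B}) :
    map_poly (map_poly h) F = \prod_(Q <- map (map_poly h) orb) ('X - Q%:P).
  by rewrite big_map [LHS]map_prod_XsubC.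
have F_inv h : H h -> map_poly (map_poly h) F = F.
  move=> Hh; rewrite mapF; apply/perm_big/perm_map_stable => // [|Q /orbP[h1 Hh1 ->]].
    exact/map_inj_poly/rmorph0/H_inj.
  by apply/orbP; exists (h \o h1)%FUN; [exact: H_comp | rewrite -map_poly_comp].
have fgF : map_poly (map_poly f) F = map_poly (map_poly g) F.
  apply/polyP => j; rewrite !coef_map; apply/polyP => i; rewrite !coef_map /=.
  apply: fg => h /F_inv/polyP/(_ j); rewrite coef_map => /polyP/(_ i).
  by rewrite coef_map.
have theta_orb : theta \in orb by apply/orbP; exists idfun => //; rewrite map_poly_id.
have : root (map_poly (map_poly f) F) (map_poly f theta).
  by rewrite mapF root_prod_XsubC map_f.
rewrite fgF mapF root_prod_XsubC.
case/mapP => _ /orbP[h Hh ->] /polyP Dtheta; exists h => // r rs_r.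
have := Dtheta (index r rs).
by rewrite !coef_map coef_poly index_mem rs_r /= nth_index.
Qed.

End MorphismsAgreeingOnInvariants.

Section RamifiedSquareRoot.
Variables (q : nat) (K : fieldType) (red : {rmorphism algInt -> K}).
Variables (d : algInt) (D : int).
Hypotheses (q_pchar : q \in [pchar K]) (d_sqr : d ^+ 2 = D%:~R)
  (D_odd : odd (logn q `|D|)).

Lemma aut_sqrtP s : algInt_aut s d = d \/ algInt_aut s d = - d.
Proof.
have /(congr1 val) : algInt_aut s d ^+ 2 = d ^+ 2 by rewrite -rmorphXn d_sqr rmorph_int.
rewrite !rmorphXn => /eqP; rewrite eqf_sqr -rmorphN.
by case/pred2P => /val_inj; [left | right].
Qed.

Lemma sqrt_neq0 : d != 0.
Proof.
apply: contraTneq D_odd => d0; move: d_sqr; rewrite d0 expr0n => /esym.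
by rewrite -[_%:R]/(0%:~R) => /algInt_intr_inj ->; rewrite logn0.
Qed.

Lemma aut_negating_sqrt : exists t, algInt_aut t d = - d.
Proof.
apply: contrapT => /forallNP no_t.
have [s|m Dm] := @algInt_fixed d; first by case: (aut_sqrtP s) => // /no_t.
have m_neq0 : m != 0 by apply: contra_neq sqrt_neq0 => m0; rewrite Dm m0.
have /(odd_logn_square_dvd D_odd m_neq0) : m ^+ 2 = 1 * D.
  by apply: algInt_intr_inj; rewrite mul1r rmorphXn /= -Dm d_sqr.
by rewrite dvdzE /= dvdn1 => /eqP q1; have := pcharf_prime q_pchar; rewrite q1.
Qed.

Lemma aut_conj_sub t s a (x : algInt := algInt_aut t a - a) : algInt_aut t d = - d ->
  (forall s, algInt_aut s d = d -> algInt_aut s a = a) ->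
  algInt_aut s d = d /\ algInt_aut s x = x \/ algInt_aut s d = - d /\ algInt_aut s x = - x.
Proof.
move=> td fix_a; pose u := algC_invaut t.
have tK y : algInt_aut u (algInt_aut t y) = y by apply/val_inj/algC_autK.
have uK y : algInt_aut t (algInt_aut u y) = y by apply/val_inj/algC_invautK.
have ud : algInt_aut u d = - d by rewrite -[d in LHS]opprK rmorphN /= -td tK.
have negA r : algInt_aut r d = - d -> algInt_aut r a = algInt_aut t a.
  move=> rd; apply: (can_inj uK); rewrite tK -algInt_aut_comp fix_a //.
  by rewrite algInt_aut_comp rd rmorphN /= ud opprK.
case: (aut_sqrtP s) => sd; [left | right]; split; rewrite // rmorphB /= -algInt_aut_comp.
  by rewrite (fix_a s) // negA // algInt_aut_comp td rmorphN /= sd.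
by rewrite (negA s) // fix_a ?opprB // algInt_aut_comp td rmorphN /= sd opprK.
Qed.

(* The extension Q(d)/Q is ramified at q: for x = t(a) - a, both x^2 and x d are
   rational integers, and (x d)^2 = x^2 D forces q to divide x^2. *)
Lemma red_conj_sqrt_stabiliser t a : algInt_aut t d = - d ->
  (forall s, algInt_aut s d = d -> algInt_aut s a = a) -> red (algInt_aut t a) = red a.
Proof.
move=> td fix_a; pose x : algInt := algInt_aut t a - a.
have aut_x s := aut_conj_sub s td fix_a.
have [s|e De] := @algInt_fixed (x ^+ 2).
  by rewrite rmorphXn /=; case: (aut_x s) => -[_ ->] //; rewrite sqrrN.
have [s|m Dm] := @algInt_fixed (x * d).
  by rewrite rmorphM /=; case: (aut_x s) => -[-> ->] //; rewrite mulrNN.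
have Dme : m ^+ 2 = e * D.
  by apply: algInt_intr_inj; rewrite rmorphXn rmorphM /= -Dm -De -d_sqr exprMn.
apply/eqP; rewrite -subr_eq0 -rmorphB /= -/x.
have [m0|m_neq0] := eqVneq m 0.
  suff -> : x = 0 by rewrite rmorph0.
  apply: val_inj; have /(congr1 val)/eqP : x * d = 0 by rewrite Dm m0.
  rewrite rmorphM rmorph0 mulf_eq0 => /orP[]/eqP //.
  rewrite -[0 in RHS](rmorph0 (val : {rmorphism algInt -> algC})) => /val_inj d0.
  by have := sqrt_neq0; rewrite d0 eqxx.
rewrite -[_ == 0](expf_eq0 _ 2) -rmorphXn /= De rmorph_int -(dvdz_pcharf q_pchar).
exact: odd_logn_square_dvd D_odd m_neq0 Dme.
Qed.

Lemma inertia_of_ramified_sqrt (rs : seq algInt) :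
  (forall s, {in rs, forall r, algInt_aut s r \in rs}) ->
  exists2 s, algInt_aut s d = - d & {in rs, forall r, red (algInt_aut s r) = red r}.
Proof.
move=> rs_stable; have [t td] := aut_negating_sqrt.
pose H (h : {rmorphism algInt -> algInt}) :=
  exists2 s, algInt_aut s d = d & h =1 algInt_aut s.
have [||h [s _ Dh]|h [s _ Dh] r|a|h [s sd Dh] red_h] :=
  @conj_of_eq_on_invariants algInt H rs _ _ _ _ K red (red \o algInt_aut t)%FUN.
- by exists idfun => [|x]; apply: val_inj.
- move=> h1 h2 [s1 s1d Dh1] [s2 s2d Dh2]; exists (s1 \o s2)%FUN => [|x].
    by rewrite algInt_aut_comp s2d.
  by rewrite algInt_aut_comp /= Dh1 Dh2.
- by move=> x y; rewrite !Dh => /algInt_aut_inj.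
- by rewrite Dh; apply: rs_stable.
- move=> Ha; apply/esym/red_conj_sqrt_stabiliser => // s sd.
  by apply: (Ha (algInt_aut s)); exists s.
exists (t \o s)%FUN; first by rewrite algInt_aut_comp sd.
move=> r rs_r; rewrite algInt_aut_comp -Dh.
exact/esym/red_h.
Qed.

End RamifiedSquareRoot.

(** * Discriminants and Galois permutations of roots *)

Definition diff_prod (R : comNzRingType) (rs : seq R) : R :=
  \prod_(i < size rs) \prod_(j < size rs | (i < j)%N) (rs`_i - rs`_j).

Lemma rmorph_diff_prod_fixed (R : comNzRingType) (s : {rmorphism R -> R}) (rs : seq R) :
  {in rs, s =1 id} -> s (diff_prod rs) = diff_prod rs.
Proof.
move=> fix_s; rewrite rmorph_prod; apply: eq_bigr => i _; rewrite rmorph_prod.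
by apply: eq_bigr => j _; rewrite rmorphB /= !fix_s ?mem_nth.
Qed.

Lemma horner_deriv_prod_XsubC (R : comNzRingType) (I : finType) (x : I -> R) i :
  (\prod_j ('X - (x j)%:P))^`().[x i] = \prod_(j | j != i) (x i - x j).
Proof.
rewrite (bigD1 i) //= derivM derivXsubC mul1r hornerD hornerM hornerXsubC.
rewrite subrr mul0r addr0 horner_prod; apply: eq_bigr => j _.
by rewrite hornerXsubC.
Qed.

Lemma diff_prod_sqr (R : comNzRingType) (rs : seq R) : exists e : nat,
  diff_prod rs ^+ 2 =
    (-1) ^+ e * \prod_(r <- rs) (\prod_(z <- rs) ('X - z%:P))^`().[r].
Proof.
set N := size rs; exists (\sum_(i < N) \sum_(j < N | (i < j)%N) 1)%N.
have -> : \prod_(r <- rs) (\prod_(z <- rs) ('X - z%:P))^`().[r] =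
    \prod_(i < N) (\prod_(j < N | (i < j)%N) (rs`_i - rs`_j) *
                   \prod_(j < N | (j < i)%N) (rs`_i - rs`_j)).
  rewrite [\prod_(z <- rs) ('X - _%:P)](big_nth 0) [LHS](big_nth 0) !big_mkord.
  apply: eq_bigr => i _; rewrite horner_deriv_prod_XsubC.
  rewrite (bigID (fun j : 'I_N => (i < j)%N)) /=.
  by congr (_ * _); apply: eq_bigl => j; rewrite -val_eqE; case: (ltngtP i j).
rewrite big_split mulrCA expr2; congr (_ * _).
rewrite [X in _ * X](exchange_big_dep xpredT) //= -prodrXr -big_split.
apply: eq_bigr => i _ /=; rewrite -prodrXr -big_split; apply: eq_bigr => j _ /=.
by rewrite expr1 mulN1r opprB.
Qed.

(* An inertia element negates the square root of the discriminant, hence moves some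
   root; it can only exchange roots with the same reduction. *)
Lemma transposition_of_double_reduction (q : nat) (K : fieldType)
    (red : {rmorphism algInt -> K}) (c : K) (rs : seq algInt) (D : int) :
    q \in [pchar K] -> uniq rs -> (forall s, {in rs, forall r, algInt_aut s r \in rs}) ->
    (forall x, (count_mem x (map red rs) <= (x == c).+1)%N) ->
    diff_prod rs ^+ 2 = D%:~R -> odd (logn q `|D|) ->
  exists a s, [/\ a \in rs, algInt_aut s a != a &
    {in rs, forall r, r != a -> r != algInt_aut s a -> algInt_aut s r = r}].
Proof.
move=> q_pchar rs_uniq rs_stable red_count d_sqr D_odd.
have [s sd red_s] := inertia_of_ramified_sqrt red q_pchar d_sqr D_odd rs_stable.
have count_red l x : uniq l -> {subset l <= rs} -> {in l, forall r, red r = x} ->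
    (size l <= (x == c).+1)%N.
  move=> l_uniq l_rs l_x; apply: leq_trans (red_count x).
  rewrite count_map -size_filter; apply: uniq_leq_size => // r lr.
  by rewrite mem_filter /= l_x // eqxx l_rs.
have moved_red r : r \in rs -> algInt_aut s r != r -> red r = c.
  move=> rs_r sr; apply/eqP; have := count_red [:: algInt_aut s r; r] (red r).
  rewrite /= inE sr; case: eqP => // _; apply=> // z; rewrite !inE => /pred2P[]->//.
  - exact: rs_stable.
  - exact: red_s.
have [a rs_a sa] : exists2 a, a \in rs & algInt_aut s a != a.
  apply/hasP; apply: contraT => /hasPn fix_s.
  have fix_d : algInt_aut s (diff_prod rs) = diff_prod rs.
    by apply: rmorph_diff_prod_fixed => r /fix_s; rewrite negbK => /eqP.
  have /eqP[] := sqrt_neq0 d_sqr D_odd; apply/val_inj/eqP.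
  by rewrite rmorph0 -eqNr -rmorphN -sd fix_d.
exists a, s; split=> // r rs_r ra rsa; apply/eqP; apply: contraT => sr.
have := count_red [:: r; algInt_aut s a; a] c.
rewrite /= !inE !negb_or ra rsa sa eqxx; apply=> // z; rewrite !inE => /or3P[]/eqP-> //.
- exact: rs_stable.
- exact: moved_red.
- by rewrite red_s // moved_red.
- exact: moved_red.
Qed.

Lemma algInt_roots_exist (f : {poly int}) : f \is monic ->
  exists rs : seq algInt, map val rs = poly_roots (qbar f).
Proof.
move=> f_mon; have fC_mon : qbar f \is monic by apply: monic_map.
have root_Aint : {in poly_roots (qbar f), forall z, z \in Aint}.
  move=> z; rewrite mem_poly_roots // => fz; apply: root_monic_Aint fz fC_mon _.
  by apply/polyOverP => i; rewrite coef_map intr_int.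
exists (pmap insub (poly_roots (qbar f))); rewrite (pmap_filter (insubK _)).
by apply/all_filterP/allP => z /root_Aint zA; rewrite isSome_insub.
Qed.

Lemma val_algInt_rootsE (f : {poly int}) (rs : seq algInt) : f \is monic ->
  map val rs = poly_roots (qbar f) -> map_poly intr f = \prod_(r <- rs) ('X - r%:P).
Proof.
move=> f_mon Drs; pose valC : {rmorphism algInt -> algC} := val.
apply: (map_inj_poly val_inj (rmorph0 valC)).
rewrite -map_poly_comp (eq_map_poly (rmorph_int valC)) -/(qbar f).
by rewrite [LHS]poly_rootsE ?monic_map // -Drs big_map [RHS]map_prod_XsubC.
Qed.

Definition gal_perms (rs : seq algC) : {set {perm seq_sub rs}} :=
  [set g : {perm seq_sub rs} |
     `[< exists s : {rmorphism algC -> algC}, forall x, val (g x) = s (val x) >]].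

Section GaloisPermutations.
Variable rs : seq algC.

Lemma gal_permsP (g : {perm seq_sub rs}) : g \in gal_perms rs <->
  exists s : {rmorphism algC -> algC}, forall x, val (g x) = s (val x).
Proof. by rewrite inE; split=> /asboolP. Qed.

Lemma gal_perms_group_set : group_set (gal_perms rs).
Proof.
apply/group_setP; split=> [|g h /gal_permsP[s Ds] /gal_permsP[t Dt]].
  by apply/gal_permsP; exists idfun => x; rewrite perm1.
by apply/gal_permsP; exists (t \o s)%FUN => x; rewrite permM Dt Ds.
Qed.

Canonical gal_perms_group := Group gal_perms_group_set.

Lemma gal_perm_of_aut (s : {rmorphism algC -> algC}) : {in rs, forall r, s r \in rs} ->
  exists2 g, g \in gal_perms rs & forall x, val (g x) = s (val x).
Proof.
move=> rs_stable; pose g (x : seq_sub rs) : seq_sub rs := SeqSub (rs_stable _ (valP x)).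
have g_inj : injective g by move=> x y /(congr1 val)/fmorph_inj/val_inj.
exists (perm g_inj) => [|x]; last by rewrite permE.
by apply/gal_permsP; exists s => x; rewrite permE.
Qed.

Definition has_gal_transposition := exists x y : seq_sub rs,
  x != y /\ tperm x y \in gal_perms rs.

Lemma gal_transposition_of_aut (s : {rmorphism algC -> algC}) (a : algC) :
  {in rs, forall r, s r \in rs} -> a \in rs -> s a != a ->
  {in rs, forall r, r != a -> r != s a -> s r = r} -> has_gal_transposition.
Proof.
move=> rs_stable rs_a sa fix_s; have [g gG Dg] := gal_perm_of_aut rs_stable.
pose x : seq_sub rs := SeqSub rs_a; exists x, (g x).
have gx : g x != x by rewrite -val_eqE Dg.
split; first by rewrite eq_sym.
suff <- : g = tperm x (g x) by [].
have fix_g z : z != x -> z != g x -> g z = z.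
  by rewrite -!val_eqE Dg => za zsa; apply: val_inj; rewrite Dg fix_s // (valP z).
apply/permP => z; case: tpermP => [->//|->|/eqP zx /eqP zgx]; last exact: fix_g.
apply/eqP; apply: contraT => ggx; have := fix_g _ ggx.
by rewrite (inj_eq perm_inj) => /(_ gx)/perm_inj/perm_inj/eqP; rewrite (negPf gx).
Qed.

End GaloisPermutations.

Lemma size_qbar (f : {poly int}) : size (qbar f) = size f.
Proof. exact: size_map_inj_poly intr_inj (mulr0z 1) f. Qed.

Lemma root_qbar_aut (f : {poly int}) (s : {rmorphism algC -> algC}) z :
  root (qbar f) (s z) = root (qbar f) z.
Proof.
rewrite -[in RHS](fmorph_root s) /qbar -map_poly_comp.
by congr (root _ _); apply: eq_map_poly => m; rewrite /= rmorph_int.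
Qed.

Section GaloisGroupOfPolynomial.
Variable f : {poly int}.
Hypothesis f_mon : f \is monic.

Let qbar_mon : qbar f \is monic. Proof. exact: monic_map. Qed.

Lemma map_ratr_intr : map_poly (ratr : rat -> algC) (map_poly intr f) = qbar f.
Proof. by rewrite -map_poly_comp; apply: eq_map_poly => m; rewrite /= ratr_int. Qed.

Lemma poly_roots_aut (s : {rmorphism algC -> algC}) :
  {in poly_roots (qbar f), forall z, s z \in poly_roots (qbar f)}.
Proof. by move=> z; rewrite !mem_poly_roots // root_qbar_aut. Qed.

Lemma algInt_roots_aut (rs : seq algInt) s : map val rs = poly_roots (qbar f) ->
  {in rs, forall r, algInt_aut s r \in rs}.
Proof.
move=> Drs r rs_r; rewrite -(mem_map val_inj) Drs; apply: poly_roots_aut.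
by rewrite -Drs map_f.
Qed.

Lemma irreducible_separable_qbar : irreducible_poly f -> separable_poly (qbar f).
Proof.
move=> /irreducible_rat_int/(irreducible_poly_separable (pchar_num _)).
by rewrite -(separable_map (ratr : {rmorphism rat -> algC})) map_ratr_intr.
Qed.

Lemma gal_perms_transitive : irreducible_poly f ->
  [transitive gal_perms (poly_roots (qbar f)), on [set: _] | 'P].
Proof.
move=> irr_f; have trans x y : exists2 g, g \in gal_perms (poly_roots (qbar f)) & g x = y.
  have [|||s sxy] := @irreducible_poly_conj (map_poly intr f) (val x) (val y).
  - exact/irreducible_rat_int.
  - by rewrite map_ratr_intr -mem_poly_roots ?(valP x).
  - by rewrite map_ratr_intr -mem_poly_roots ?(valP y).
  have [g gG Dg] := gal_perm_of_aut (poly_roots_aut s).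
  by exists g => //; apply: val_inj; rewrite Dg.
have [z fz] : exists z, z \in poly_roots (qbar f).
  have [z fz] : exists z, root (qbar f) z.
    by apply/closed_rootP; rewrite size_qbar gtn_eqF ?irr_f.1.
  by exists z; rewrite mem_poly_roots.
pose x0 : seq_sub (poly_roots (qbar f)) := SeqSub fz.
apply/imsetP; exists x0 => //; apply/setP => y; rewrite inE; apply/esym/imsetP.
by have [g gG <-] := trans x0 y; exists g.
Qed.

End GaloisGroupOfPolynomial.

(** * Iterates of polynomials *)

Definition poly_iter (R : comNzRingType) (f : {poly R}) (n : nat) : {poly R} :=
  iter n (fun g => f \Po g) 'X.

Lemma iter_polyE (f : {poly int}) n : iter_poly f n = poly_iter f n.
Proof. by []. Qed.

Section PolynomialIterates.
Variables (R : comNzRingType) (f : {poly R}).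

Lemma horner_poly_iter n x : (poly_iter f n).[x] = iter n (horner f) x.
Proof. by elim: n => [|n IHn]; rewrite ?hornerX //= horner_comp IHn. Qed.

Lemma poly_iterSr n : poly_iter f n.+1 = poly_iter f n \Po f.
Proof.
elim: n => [|n IHn]; first by rewrite /= comp_polyX comp_polyXr.
by rewrite -[LHS]/(f \Po poly_iter f n.+1) {1}IHn comp_polyA.
Qed.

Lemma map_poly_iter (S : comNzRingType) (h : {rmorphism R -> S}) n :
  map_poly h (poly_iter f n) = poly_iter (map_poly h f) n.
Proof. by elim: n => [|n IHn]; rewrite ?map_polyX //= map_comp_poly IHn. Qed.

Lemma rmorph_iter_horner (S : comNzRingType) (h : {rmorphism R -> S}) n x :
  h (iter n (horner f) x) = iter n (horner (map_poly h f)) (h x).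
Proof. by elim: n => //= n <-; rewrite horner_map. Qed.

Lemma deriv_poly_iterSr n x :
  (poly_iter f n.+1)^`().[x] = (poly_iter f n)^`().[f.[x]] * f^`().[x].
Proof. by rewrite poly_iterSr deriv_comp hornerM horner_comp. Qed.

End PolynomialIterates.

Section PolynomialIterateDegree.
Variables (R : idomainType) (f : {poly R}).
Hypothesis f_gt1 : (1 < size f)%N.

Lemma size_poly_iter n : size (poly_iter f n) = ((size f).-1 ^ n).+1.
Proof.
have d_gt0 : (0 < (size f).-1)%N by rewrite -subn1 subn_gt0.
elim: n => [|n IHn]; first by rewrite size_polyX.
rewrite -[LHS]prednK ?size_comp_poly ?IHn ?expnS // size_poly_gt0.
rewrite comp_poly_eq0 ?IHn ?ltnS ?expn_gt0 ?d_gt0 // -size_poly_gt0; exact: ltnW.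
Qed.

Lemma monic_poly_iter n : f \is monic -> poly_iter f n \is monic.
Proof.
move=> f_mon; elim: n => [|n IHn]; first exact: monicX.
have d_gt0 : (0 < (size f).-1)%N by rewrite -subn1 subn_gt0.
apply/monicP; rewrite lead_coef_comp ?size_poly_iter ?ltnS ?expn_gt0 ?d_gt0 //.
by rewrite (monicP f_mon) (monicP IHn) expr1n mulr1.
Qed.

End PolynomialIterateDegree.

Lemma iter_poly_monic (f : {poly int}) n :
  f \is monic -> (1 < size f)%N -> iter_poly f n \is monic.
Proof. by move=> f_mon f_gt1; apply: monic_poly_iter. Qed.

Lemma root_derivn_exp_XsubC (R : comNzRingType) (x : R) (g : {poly R}) m :
  root (('X - x%:P) ^+ m.+1 * g)^`(m) x.
Proof.
elim: m g => [|m IHm] g; first by rewrite rootE expr1 hornerM hornerXsubC subrr mul0r.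
rewrite derivSn derivM deriv_exp derivXsubC mul1r /=.
have -> : ('X - x%:P) ^+ m.+1 *+ m.+2 * g + ('X - x%:P) ^+ m.+2 * g^`() =
    ('X - x%:P) ^+ m.+1 * (g *+ m.+2 + ('X - x%:P) * g^`()).
  by rewrite mulrDr mulrA -exprSr mulrnAl mulrnAr.
exact: IHm.
Qed.

Lemma count_mem_le_derivn (R : comNzRingType) (rs : seq R) (x : R) m :
  ~~ root (\prod_(r <- rs) ('X - r%:P))^`(m) x -> (count_mem x rs <= m)%N.
Proof.
apply: contraNT; rewrite -ltnNge => lt_m.
have -> : \prod_(r <- rs) ('X - r%:P) = ('X - x%:P) ^+ m.+1 *
   (('X - x%:P) ^+ (count_mem x rs - m.+1) * \prod_(r <- rs | r != x) ('X - r%:P)).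
  rewrite mulrA -exprD subnKC // (bigID (pred1 x)) /=; congr (_ * _).
  rewrite (eq_bigr (fun=> 'X - x%:P)) => [|r /eqP->//].
  by rewrite big_const_seq iter_mulr_1.
exact: root_derivn_exp_XsubC.
Qed.

Lemma count_mem_simple_root (K : idomainType) (rs : seq K) (x : K)
    (f := \prod_(r <- rs) ('X - r%:P)) :
  (root f x -> f^`().[x] != 0) -> (count_mem x rs <= 1)%N.
Proof.
rewrite root_prod_XsubC; have [rs_x simple_x|/count_memPn ->//] := boolP (x \in rs).
by apply: count_mem_le_derivn; rewrite derivn1 simple_x.
Qed.

Section CriticalOrbits.
Variables (K : idomainType) (f : {poly K}).

Lemma simple_root_poly_iter n y :
  (forall z j, root f^`() z -> (0 < j <= n)%N -> iter j (horner f) z != 0) ->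
  root (poly_iter f n) y -> (poly_iter f n)^`().[y] != 0.
Proof.
rewrite rootE horner_poly_iter.
elim: n y => [|n IHn] y crit_n; first by rewrite derivX hornerC oner_neq0.
rewrite iterSr deriv_poly_iterSr => fy; rewrite mulf_neq0 //.
  apply: IHn => // z j z_crit /andP[j_gt0 le_jn].
  by rewrite crit_n // j_gt0 leqW.
by apply/negP => /(crit_n y n.+1); rewrite ltnS leqnn iterSr fy => /(_ isT).
Qed.

Variables (c : K) (n : nat).
Hypothesis crit_other : forall z j, root f^`() z -> z != c -> (0 < j <= n.+1)%N ->
  iter j (horner f) z != 0.
Hypothesis crit_primitive : forall j, (0 < j <= n)%N -> iter j (horner f) c != 0.

Lemma crit_iter_neq0 z j :
  root f^`() z -> (0 < j <= n)%N -> iter j (horner f) z != 0.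
Proof.
have [->|zc] := eqVneq z c; first by move=> _; apply: crit_primitive.
by move=> z_crit /andP[j_gt0 /leqW le_jn]; rewrite crit_other // j_gt0.
Qed.

Lemma simple_root_poly_iterS y : y != c ->
  root (poly_iter f n.+1) y -> (poly_iter f n.+1)^`().[y] != 0.
Proof.
rewrite rootE horner_poly_iter iterSr deriv_poly_iterSr => yc fy; rewrite mulf_neq0 //.
  apply: simple_root_poly_iter; first exact: crit_iter_neq0.
  by rewrite rootE horner_poly_iter.
apply/negP => /(crit_other (j := n.+1))/(_ yc).
by rewrite ltnS leqnn iterSr fy => /(_ isT).
Qed.

Lemma double_root_poly_iterS : root f^`() c -> ~~ root f^`(2) c ->
  root (poly_iter f n.+1) c -> ~~ root (poly_iter f n.+1)^`(2) c.
Proof.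
rewrite ![root _ c]rootE horner_poly_iter iterSr => /eqP dfc d2fc fc.
rewrite poly_iterSr !derivnS !derivn0 deriv_comp derivM hornerD !hornerM dfc mulr0 add0r.
rewrite horner_comp mulf_neq0 //.
apply: simple_root_poly_iter; first exact: crit_iter_neq0.
by rewrite rootE horner_poly_iter.
Qed.

End CriticalOrbits.

Lemma rmorph_prod_horner (R S : comNzRingType) (h : {rmorphism R -> S}) (g : {poly R})
    (rs : seq R) :
  h (\prod_(r <- rs) g.[r]) = \prod_(r <- rs) (map_poly h g).[h r].
Proof. by rewrite rmorph_prod; apply: eq_bigr => r _; rewrite horner_map. Qed.

Lemma prod_horner_roots_int (f : {poly int}) (g : {poly int}) (rs : seq algInt) :
  f \is monic -> map val rs = poly_roots (qbar f) -> uniq rs ->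
  exists m : int, \prod_(r <- rs) (map_poly intr g).[r] = m%:~R.
Proof.
move=> f_mon Drs rs_uniq; apply: algInt_fixed => s.
have rs_stable := algInt_roots_aut f_mon s Drs.
rewrite rmorph_prod_horner -map_poly_comp (eq_map_poly (rmorph_int (algInt_aut s))).
rewrite -(big_map (algInt_aut s) xpredT (horner (map_poly intr g))).
exact/perm_big/perm_map_stable/rs_stable/rs_uniq/algInt_aut_inj.
Qed.

Section TranspositionOfCriticalOrbit.
Variables (f : {poly int}) (n q : nat) (K : fieldType) (red : {rmorphism algInt -> K}).
Hypotheses (f_mon : f \is monic) (f_gt1 : (1 < size f)%N)
  (irr_iter : irreducible_poly (iter_poly f n.+1)) (q_pchar : q \in [pchar K]).

Local Notation fA := (map_poly (intr : int -> algInt) f).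
Local Notation fK := (map_poly (intr : int -> K) f).

Variable c : K.
Hypotheses (c_crit : root fK^`() c) (c_simple : ~~ root fK^`(2) c)
  (c_root : root (poly_iter fK n.+1) c).
Hypothesis crit_other : forall z j, root fK^`() z -> z != c -> (0 < j <= n.+1)%N ->
  iter j (horner fK) z != 0.
Hypothesis crit_primitive : forall j, (0 < j <= n)%N -> iter j (horner fK) c != 0.

Section Roots.
Variable rs : seq algInt.
Hypotheses (rs_roots : map val rs = poly_roots (qbar (iter_poly f n.+1)))
  (rs_uniq : uniq rs).

Lemma algInt_poly_iterE : poly_iter fA n.+1 = \prod_(r <- rs) ('X - r%:P).
Proof.
by rewrite -map_poly_iter -iter_polyE (val_algInt_rootsE _ rs_roots) ?iter_poly_monic.
Qed.

Lemma residue_poly_iterE : poly_iter fK n.+1 = \prod_(r <- map red rs) ('X - r%:P).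
Proof.
rewrite -map_poly_iter -(eq_map_poly (rmorph_int red)) map_poly_comp map_poly_iter.
by rewrite algInt_poly_iterE prod_map_poly.
Qed.

Lemma count_reduced_roots x : (count_mem x (map red rs) <= (x == c).+1)%N.
Proof.
have [->|xc] := eqVneq x c.
  by apply: count_mem_le_derivn; rewrite -residue_poly_iterE double_root_poly_iterS.
apply: count_mem_simple_root; rewrite -residue_poly_iterE.
exact: simple_root_poly_iterS xc.
Qed.

Lemma prod_deriv_parent_int : exists2 u : int, ~~ (q %| u)%Z &
  \prod_(r <- rs) (poly_iter fA n)^`().[fA.[r]] = u%:~R.
Proof.
have [u Du] := prod_horner_roots_int ((poly_iter f n)^`() \Po f)
  (iter_poly_monic n.+1 f_mon f_gt1) rs_roots rs_uniq.
exists u; last first.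
  rewrite -Du; apply: eq_bigr => r _.
  by rewrite map_comp_poly horner_comp -deriv_map map_poly_iter.
rewrite (dvdz_pcharf q_pchar) -(rmorph_int red) -Du rmorph_prod_horner.
rewrite prodf_seq_neq0; apply/allP => r rs_r /=.
rewrite -map_poly_comp (eq_map_poly (rmorph_int red)) map_comp_poly horner_comp.
rewrite -deriv_map map_poly_iter; apply: simple_root_poly_iter.
  exact: crit_iter_neq0 crit_other crit_primitive.
rewrite rootE -horner_comp -poly_iterSr -rootE residue_poly_iterE root_prod_XsubC.
exact: map_f.
Qed.

Lemma odd_discriminant (m : int) :
  \prod_(r <- rs) fA^`().[r] = m%:~R -> odd (logn q `|m|) ->
  exists2 D : int, diff_prod rs ^+ 2 = D%:~R & odd (logn q `|D|).
Proof.
move=> Dm m_odd; have [e ->] := diff_prod_sqr rs; rewrite -algInt_poly_iterE.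
have [u q_ndvd_u Du] := prod_deriv_parent_int; exists ((-1) ^+ e * (u * m)).
  rewrite (eq_bigr _ (fun r _ => deriv_poly_iterSr _ _ r)) big_split /= Du Dm.
  by rewrite !rmorphM rmorphXn /= rmorphN1.
rewrite !abszM abszX exp1n mul1n logn_Gauss // prime_coprime -?dvdzE //.
exact: pcharf_prime q_pchar.
Qed.

End Roots.

(* Modulo q, the iterate f^(n+1) has the double root c and otherwise simple roots. *)
Lemma gal_transposition_of_critical_orbit :
  (forall rs : seq algInt, poly_iter fA n.+1 = \prod_(r <- rs) ('X - r%:P) ->
    exists2 m : int, \prod_(r <- rs) fA^`().[r] = m%:~R & odd (logn q `|m|)) ->
  has_gal_transposition (poly_roots (qbar (iter_poly f n.+1))).
Proof.
move=> deriv_odd; have iter_mon := iter_poly_monic n.+1 f_mon f_gt1.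
have [rs Drs] := algInt_roots_exist iter_mon.
have rs_uniq : uniq rs.
  rewrite -(map_inj_uniq val_inj) Drs uniq_poly_roots ?monic_map //.
  exact: irreducible_separable_qbar.
have [m Dm m_odd] := deriv_odd rs (algInt_poly_iterE Drs).
have [D D_sqr D_odd] := odd_discriminant Drs rs_uniq Dm m_odd.
have rs_stable s := algInt_roots_aut iter_mon s Drs.
have [a [s [rs_a sa fix_s]]] := transposition_of_double_reduction q_pchar rs_uniq
  rs_stable (count_reduced_roots Drs) D_sqr D_odd.
apply: (@gal_transposition_of_aut _ s (val a)).
- exact: poly_roots_aut.
- by rewrite -Drs map_f.
- by rewrite -[s _]/(val (algInt_aut s a)) (inj_eq val_inj).
move=> z; rewrite -Drs => /mapP[r rs_r ->].
rewrite -![s _]/(val (algInt_aut s _)) !(inj_eq val_inj) => ra rsa.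
by rewrite fix_s.
Qed.

End TranspositionOfCriticalOrbit.

(** * Automorphisms of the preimage tree *)

Lemma horner_qbar_aut (f : {poly int}) (s : {rmorphism algC -> algC}) x :
  (qbar f).[s x] = s (qbar f).[x].
Proof.
rewrite -horner_map /= -map_poly_comp; congr _.[_].
by apply: eq_map_poly => m; rewrite /= rmorph_int.
Qed.

Lemma gal_image_tree_aut (f : {poly int}) (h : tree_vertex f -> tree_vertex f) :
  gal_image h -> tree_aut h.
Proof.
move=> [s _ Dh]; split; last first.
  move=> u v; rewrite /tree_adj !Dh /= !horner_qbar_aut.
  by split=> -[[-> D]|[-> D]]; [left|right|left|right]; split=> //;
    [rewrite D | rewrite D | apply: fmorph_inj D | apply: fmorph_inj D].
have inv_vertex (v : tree_vertex f) :
    root (qbar (iter_poly f (val v).1)) (algC_invaut s (val v).2).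
  by rewrite (root_qbar_aut _ (algC_invaut s)) (valP v).
exists (fun v => exist _ ((val v).1, algC_invaut s (val v).2) (inv_vertex v)) => v;
  apply: val_inj.
  by rewrite /= Dh /= algC_autK; case: (val v).
by rewrite Dh /= algC_invautK; case: (val v).
Qed.

Section PreimageTree.
Variables (phi : {poly int}) (p : nat).
Hypotheses (phi_mon : phi \is monic) (p_pr : prime p) (size_phi : size phi = p.+1).
Hypothesis irr_iter : forall n, irreducible_poly (iter_poly phi n.+1).

Local Notation F := (horner (qbar phi)).
Local Notation vertex := (tree_vertex phi).

Definition level n : seq algC := poly_roots (qbar (iter_poly phi n)).

Lemma qbar_iter_poly n : qbar (iter_poly phi n) = poly_iter (qbar phi) n.
Proof. by rewrite iter_polyE /qbar map_poly_iter. Qed.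

Lemma qbar_iter_poly_monic n : qbar (iter_poly phi n) \is monic.
Proof. by rewrite monic_map ?iter_poly_monic // size_phi ltnS prime_gt0. Qed.

Lemma mem_level n x : (x \in level n) = (iter n F x == 0).
Proof.
by rewrite mem_poly_roots ?qbar_iter_poly_monic // qbar_iter_poly rootE horner_poly_iter.
Qed.

Lemma mem_level0 x : (x \in level 0) = (x == 0).
Proof. exact: mem_level. Qed.

Lemma mem_levelS n x : (x \in level n.+1) = (F x \in level n).
Proof. by rewrite !mem_level iterSr. Qed.

Lemma separable_iter_polyS n : separable_poly (qbar (iter_poly phi n.+1)).
Proof. exact/irreducible_separable_qbar/irr_iter. Qed.

Definition fiber b : seq algC := poly_roots (qbar phi - b%:P).

Lemma fiber_poly_spec b : (qbar phi - b%:P \is monic) * (size (qbar phi - b%:P) = p.+1).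
Proof.
have size_qphi : size (qbar phi) = p.+1 by rewrite size_qbar.
have lt_b : (size (- b%:P) < size (qbar phi))%N.
  by rewrite size_polyN (leq_ltn_trans (size_polyC_leq1 b)) // size_qphi ltnS prime_gt0.
by rewrite monicE lead_coefDl // size_polyDl // -monicE monic_map.
Qed.

Lemma mem_fiber b z : (z \in fiber b) = (F z == b).
Proof.
by rewrite mem_poly_roots ?fiber_poly_spec // rootE hornerD hornerN hornerC subr_eq0.
Qed.

Lemma size_fiber b : size (fiber b) = p.
Proof. by rewrite size_poly_roots fiber_poly_spec. Qed.

Lemma fiber_uniq n b : b \in level n -> uniq (fiber b).
Proof.
move=> bn; rewrite uniq_poly_roots ?fiber_poly_spec //; apply/separable_poly_algCP => z.
rewrite -mem_poly_roots ?fiber_poly_spec // mem_fiber derivB derivC subr0 => /eqP Fz.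
have zn : z \in level n.+1 by rewrite mem_levelS Fz.
have /separable_poly_algCP/(_ z) := separable_iter_polyS n.
rewrite -mem_poly_roots ?qbar_iter_poly_monic // => /(_ zn).
by rewrite qbar_iter_poly deriv_poly_iterSr mulf_eq0 negb_or => /andP[].
Qed.

Lemma card_fiber n (x : seq_sub (level n.+1)) :
  #|[set y : seq_sub (level n.+1) | F (val y) == F (val x)]| = p.
Proof.
have Fx : F (val x) \in level n by rewrite -mem_levelS (valP x).
rewrite -(size_fiber (F (val x))) cardE -(size_map val).
apply/perm_size/uniq_perm; rewrite ?(fiber_uniq Fx) //.
  by rewrite map_inj_uniq ?enum_uniq //; apply: val_inj.
move=> z; rewrite mem_fiber; apply/mapP/idP => [[y]|/eqP Fz].
  by rewrite mem_enum inE => Fy ->.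
have zn : z \in level n.+1 by rewrite mem_levelS Fz.
by exists (SeqSub zn); rewrite // mem_enum inE /= Fz.
Qed.

Hypothesis transposition_exists : forall n, has_gal_transposition (level n.+1).

Lemma fiberwise_perm_realized n (g : algC -> algC) :
  {in level n.+1, forall x, F (g x) = F x} -> {in level n.+1 &, injective g} ->
  exists s : {rmorphism algC -> algC}, {in level n.+1, s =1 g}.
Proof.
move=> Fg g_inj; have gn x : x \in level n.+1 -> g x \in level n.+1.
  by move=> xn; rewrite mem_levelS Fg // -mem_levelS.
pose h (x : seq_sub (level n.+1)) : seq_sub (level n.+1) := SeqSub (gn _ (valP x)).
have h_inj : injective h.
  by move=> x y /(congr1 val)/(g_inj _ _ (valP x) (valP y))/val_inj.
have [a [b [ab abG]]] := transposition_exists n.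
have /gal_permsP[s Ds] : perm h_inj \in gal_perms (level n.+1).
  apply: (@fiberwise_perm_of_transposition _ _ (fun x => F (val x)) _ _ _ p a b) => //.
  - by move=> u x y /gal_permsP[s Ds] Fxy; rewrite !Ds !horner_qbar_aut Fxy.
  - apply: gal_perms_transitive (irr_iter n).
    by rewrite iter_poly_monic // size_phi ltnS prime_gt0.
  - exact: card_fiber.
  - by move=> x; rewrite permE Fg // (valP x).
by exists s => x xn; have := Ds (SeqSub xn); rewrite permE /= => ->.
Qed.

Section CompatibleLevelMaps.
Variable g : nat -> algC -> algC.
Hypotheses (g_level : forall n, {in level n, forall x, g n x \in level n})
  (g_inj : forall n, {in level n &, injective (g n)})
  (g_parent : forall n, {in level n.+1, forall x, F (g n.+1 x) = g n (F x)}).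

Lemma level_map_realized n : exists s : {rmorphism algC -> algC}, {in level n, s =1 g n}.
Proof.
elim: n => [|n [s0 Ds0]].
  exists idfun => x x0; have := g_level x0.
  by move: x0; rewrite !mem_level0 => /eqP -> /eqP ->.
have Fg x : x \in level n.+1 -> F (algC_invaut s0 (g n.+1 x)) = F x.
  move=> xn; rewrite (horner_qbar_aut _ (algC_invaut s0)) g_parent // -Ds0 -?mem_levelS //.
  exact: algC_autK.
have [|s Ds] := fiberwise_perm_realized Fg.
  by move=> x y xn yn /fmorph_inj; apply: g_inj.
by exists (s0 \o s)%FUN => x xn /=; rewrite Ds // algC_invautK.
Qed.

Lemma realized_lower_level (s : {rmorphism algC -> algC}) n :
  {in level n.+1, s =1 g n.+1} -> {in level n, s =1 g n}.
Proof.
move=> Ds x xn; have [y] : exists y, y \in fiber x.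
  have := size_fiber x; case: (fiber x) => [|y l] sz; last by exists y; rewrite mem_head.
  by move: (prime_gt0 p_pr); rewrite -sz.
rewrite mem_fiber => /eqP Fy; have yn : y \in level n.+1 by rewrite mem_levelS Fy.
by rewrite -Fy -horner_qbar_aut Ds // g_parent.
Qed.

Lemma realized_lower_levels (s : {rmorphism algC -> algC}) k n :
  {in level (k + n), s =1 g (k + n)%N} -> {in level n, s =1 g n}.
Proof. by elim: k => // k IHk /realized_lower_level. Qed.

Lemma level_maps_realized : exists s : {rmorphism algC -> algC},
  forall n, {in level n, s =1 g n}.
Proof.
have [s_ Ds_] := choice level_map_realized; have [s Ds] := aut_limit s_.
exists s => n x xn; apply: Ds; exists n => // m /= le_nm.
by apply: (realized_lower_levels (k := m - n)) xn; rewrite subnK.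
Qed.

End CompatibleLevelMaps.

Lemma vertex_level (v : vertex) : (val v).2 \in level (val v).1.
Proof. by rewrite mem_poly_roots ?qbar_iter_poly_monic // (valP v). Qed.

Lemma origin_root : root (qbar (iter_poly phi (0%N, 0 : algC).1)) (0%N, 0 : algC).2.
Proof. by rewrite qbar_iter_poly rootE hornerX. Qed.

Definition origin : vertex := exist _ (0%N, 0) origin_root.

Definition vert n x : vertex := insubd origin (n, x).

Lemma val_vert n x : x \in level n -> val (vert n x) = (n, x).
Proof. by rewrite mem_poly_roots ?qbar_iter_poly_monic // => xn; rewrite insubdK. Qed.

Lemma vertE (v : vertex) : v = vert (val v).1 (val v).2.
Proof. by apply: val_inj; rewrite val_vert ?vertex_level //; case: (val v). Qed.

Definition parent (v : vertex) : vertex := vert (val v).1.-1 (F (val v).2).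

Lemma val_parent v n : (val v).1 = n.+1 -> val (parent v) = (n, F (val v).2).
Proof.
by move=> Dn; rewrite /parent Dn val_vert // -mem_levelS -Dn vertex_level.
Qed.

Lemma tree_adjE u v :
  tree_adj u v <->
  ((val v).1 = (val u).1.+1 /\ parent v = u) \/ ((val u).1 = (val v).1.+1 /\ parent u = v).
Proof.
have parentE x y : (val y).1 = (val x).1.+1 -> (parent y = x <-> F (val y).2 = (val x).2).
  move=> Dy; split=> [<-|Fy]; first by rewrite (val_parent Dy).
  by apply: val_inj; rewrite (val_parent Dy) Fy; case: (val x).
by split=> -[[D /(parentE _ _ D)]|[D /(parentE _ _ D)]]; [left|right|left|right].
Qed.

Definition neighbours (v : vertex) : seq vertex :=
  (if (val v).1 is _.+1 then [:: parent v] else [::]) ++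
  [seq vert (val v).1.+1 z | z <- fiber (val v).2].

Lemma mem_neighbours u v : tree_adj u v <-> v \in neighbours u.
Proof.
rewrite tree_adjE mem_cat; split=> [[[Dv <-]|[Du <-]]|/orP[]].
- apply/orP; right; apply/mapP; exists (val v).2; rewrite ?mem_fiber ?(val_parent Dv) //.
  by rewrite -Dv -vertE.
- by apply/orP; left; rewrite Du mem_head.
- case Du: (val u).1 => [//|n]; rewrite inE => /eqP ->; right; split=> //.
  by rewrite (val_parent Du).
- case/mapP => z; rewrite mem_fiber => /eqP Fz ->; left.
  have zn : z \in level (val u).1.+1 by rewrite mem_levelS Fz vertex_level.
  by rewrite /parent val_vert // Fz -vertE.
Qed.

Lemma neighbours_uniq v : uniq (neighbours v).
Proof.
have val_child z : z \in fiber (val v).2 ->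
    val (vert (val v).1.+1 z) = ((val v).1.+1, z).
  by rewrite mem_fiber => /eqP Fz; rewrite val_vert // mem_levelS Fz vertex_level.
have children_uniq : uniq [seq vert (val v).1.+1 z | z <- fiber (val v).2].
  rewrite map_inj_in_uniq ?(fiber_uniq (vertex_level v)) // => y z vy vz.
  by move/(congr1 val); rewrite !val_child // => -[].
rewrite cat_uniq children_uniq andbT has_sym; case Dv: (val v).1 => [//|n] /=.
rewrite orbF; apply/mapP => -[z vz /(congr1 (fst \o val))/=].
by rewrite -Dv val_child //= (val_parent Dv) Dv /=; lia.
Qed.

Lemma size_neighbours v : size (neighbours v) = ((0 < (val v).1) + p)%N.
Proof. by rewrite size_cat size_map size_fiber; case: (val v).1. Qed.

Section TreeAutomorphism.
Variable f : vertex -> vertex.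
Hypothesis f_aut : tree_aut f.

Let f_inj : injective f. Proof. exact: bij_inj f_aut.1. Qed.

(* The root is the only vertex with p neighbours, so f fixes its depth. *)
Lemma tree_aut_depth_gt0 v : (0 < (val (f v)).1)%N = (0 < (val v).1)%N.
Proof.
have [[h fK hK] f_adj] := f_aut.
have /perm_size : perm_eq (map f (neighbours v)) (neighbours (f v)).
  apply: uniq_perm; rewrite ?map_inj_uniq ?neighbours_uniq // => w.
  rewrite -(hK w) mem_map //; apply/idP/idP => /mem_neighbours vw.
    exact/mem_neighbours/(f_adj _ _).1.
  exact/mem_neighbours/(f_adj _ _).2.
rewrite size_map !size_neighbours => /addIn.
by case: (_ < _)%N; case: (_ < _)%N.
Qed.

Lemma tree_aut_depth_parent v :
  (val (f v)).1 = (val v).1 /\ ((0 < (val v).1)%N -> parent (f v) = f (parent v)).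
Proof.
have [n] := ubnP (val v).1; elim: n v => // n IHn v le_vn.
case Dv: (val v).1 le_vn => [|m] lt_mn.
  by split=> //; apply/eqP; rewrite -leqn0 leqNgt tree_aut_depth_gt0 Dv.
have Du := congr1 fst (val_parent Dv); set u := parent v in Du *.
have [|fu_depth fu_parent] := IHn u; first by rewrite Du.
have /f_aut.2/tree_adjE[] : tree_adj u v by apply/tree_adjE; left; rewrite Dv Du.
  by rewrite fu_depth Du => -[-> ->].
case=> Dfu fu_eq; have u_gt0 : (0 < (val u).1)%N by rewrite -fu_depth Dfu.
have /f_inj : f (parent u) = f v by rewrite -fu_parent.
move=> /(congr1 (fun w => (val w).1)); rewrite Dv.
by case: m Du {lt_mn Dv} u_gt0 => [-> //|m Du _]; rewrite (val_parent Du) /=; lia.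
Qed.

Lemma tree_aut_gal_image : gal_image f.
Proof.
pose g n x := (val (f (vert n x))).2.
have val_f n x : x \in level n -> val (f (vert n x)) = (n, g n x).
  move=> xn; rewrite [LHS]surjective_pairing.
  by rewrite (tree_aut_depth_parent _).1 val_vert.
have g_level n : {in level n, forall x, g n x \in level n}.
  by move=> x xn; have := vertex_level (f (vert n x)); rewrite val_f.
have g_inj n : {in level n &, injective (g n)}.
  move=> x y xn yn gxy; have /f_inj/(congr1 val) : f (vert n x) = f (vert n y).
    by apply: val_inj; rewrite !val_f // gxy.
  by rewrite !val_vert // => -[].
have g_parent n : {in level n.+1, forall x, F (g n.+1 x) = g n (F x)}.
  move=> x xn; have [_] := tree_aut_depth_parent (vert n.+1 x).
  rewrite {2}/parent val_vert // => /(_ isT)/(congr1 (snd \o val)) /=.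
  by rewrite (val_parent (n := n)) val_f.
have [s Ds] := level_maps_realized g_level g_inj g_parent.
exists s; first by exists (algC_invaut s); [apply: algC_autK | apply: algC_invautK].
move=> v; rewrite {1}[v]vertE val_f ?vertex_level //; congr (_, _).
exact/esym/Ds/vertex_level.
Qed.

End TreeAutomorphism.

Theorem full_arboreal_of_transpositions : full_arboreal phi.
Proof.
split=> [n|h]; first exact: separable_iter_polyS.
by split; [apply: gal_image_tree_aut | apply: tree_aut_gal_image].
Qed.

End PreimageTree.

(** * Iterates of x^p + kp x^(p-1) - kp *)

Section Trinomial.
Variables p k : nat.
Hypothesis p_gt1 : (1 < p)%N.

Local Notation phi := (phi_pk p k).

Definition crit : int := - (k * p.-1)%:R.

Section CoefficientRing.
Variable R : comNzRingType.

Local Notation phiR := (map_poly (intr : int -> R) phi).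

Lemma map_phi_pk : phiR = 'X^p + (k * p)%:R%:P * 'X^(p.-1) - (k * p)%:R%:P.
Proof.
by rewrite /phi_pk rmorphB rmorphD rmorphM /= !map_polyXn map_polyC /= rmorph_nat.
Qed.

Lemma horner_phi_pk x : phiR.[x] = x ^+ p + (k * p)%:R * x ^+ p.-1 - (k * p)%:R.
Proof. by rewrite map_phi_pk !hornerE. Qed.

Lemma iter_phi_pk0 n : iter n.+1 (horner phiR) 0 = - (k * p)%:R.
Proof.
elim: n => [|n IHn]; last rewrite iterS IHn; rewrite ?[iter 1 _ _]/= horner_phi_pk.
  by rewrite !expr0n; case: p p_gt1 => [|[|m]] //= _; rewrite mulr0 addr0 sub0r.
by case: p p_gt1 => // m _; rewrite exprS /= mulNr addNr sub0r.
Qed.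

Lemma deriv_phi_pk : phiR^`() = p%:R%:P * ('X^(p.-2) * ('X - crit%:~R%:P)).
Proof.
rewrite map_phi_pk derivB derivD derivC subr0 derivM derivC mul0r add0r !derivXn.
rewrite /crit !(rmorphN, rmorph_nat) !natrM.
by case: p p_gt1 => [|[|m]] // _; rewrite /= exprS; ring.
Qed.

Lemma horner_deriv_phi_pk x : phiR^`().[x] = p%:R * x ^+ p.-2 * (x - crit%:~R).
Proof. by rewrite deriv_phi_pk !hornerM hornerC hornerXn hornerXsubC mulrA. Qed.

Lemma prod_deriv_phi_pk (rs : seq R) (f := \prod_(r <- rs) ('X - r%:P)) :
  \prod_(r <- rs) phiR^`().[r] =
    ((-1) ^+ p.-1 * p%:R) ^+ size rs * f.[0] ^+ p.-2 * f.[crit%:~R].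
Proof.
have prod_sub x : f.[x] = \prod_(r <- rs) (x - r).
  by rewrite horner_prod; apply: eq_bigr => r _; rewrite hornerXsubC.
transitivity (\prod_(r <- rs) ((-1) ^+ p.-1 * p%:R * (0 - r) ^+ p.-2 * (crit%:~R - r))).
  apply: eq_bigr => r _; rewrite horner_deriv_phi_pk sub0r [(- r) ^+ _]exprNn.
  have -> : (-1) ^+ p.-1 = - (-1) ^+ p.-2 :> R.
    by case: p p_gt1 => [|[|m]] // _; rewrite exprS mulN1r.
  by rewrite -[LHS](signrMK p.-2); ring.
by rewrite 2!big_split /= prodrXl big_const_seq count_predT iter_mulr_1 -!prod_sub.
Qed.

End CoefficientRing.

Lemma map_phi_pk_int : map_poly intr phi = phi.
Proof. by rewrite map_poly_id // => m _; rewrite intz. Qed.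

Lemma phi_pk_monic_size : (phi \is monic) * (size phi = p.+1).
Proof.
pose g : {poly int} := (k * p)%:R%:P * 'X^(p.-1) - (k * p)%:R%:P.
have lt_g : (size g < size ('X^p : {poly int}))%N.
  rewrite size_polyXn ltnS (leq_trans (size_polyD _ _)) // geq_max; apply/andP; split.
    by rewrite mul_polyC (leq_trans (size_scale_leq _ _)) // size_polyXn prednK // ltnW.
  by rewrite size_polyN (leq_trans (size_polyC_leq1 _)) // ltnW.
have -> : phi = 'X^p + g by rewrite /g addrA.
by rewrite monicE lead_coefDl // size_polyDl // size_polyXn lead_coefXn eqxx.
Qed.

Lemma phi_pk_monic : phi \is monic. Proof. exact: phi_pk_monic_size.1. Qed.

Lemma size_phi_pk : size phi = p.+1. Proof. exact: phi_pk_monic_size.2. Qed.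

Lemma irreducible_iter_phi_pk n : prime p -> ~~ (p %| k)%N ->
  irreducible_poly (iter_poly phi n.+1).
Proof.
move=> p_pr p_ndvd_k.
have size_iter : size (iter_poly phi n.+1) = (p ^ n.+1).+1.
  by rewrite iter_polyE size_poly_iter size_phi_pk // ltnS ltnW.
have size_gt0 : (0 < p ^ n.+1)%N by rewrite expn_gt0 prime_gt0.
have map_iter m : map_poly (intr : int -> 'F_p) (iter_poly phi m) = 'X^(p ^ m).
  rewrite iter_polyE map_poly_iter map_phi_pk.
  rewrite natrM (pcharf0 (pchar_Fp p_pr)) mulr0 mul0r addr0 subr0.
  by elim: m => //= m ->; rewrite comp_Xn_poly -exprM mulnC -expnS.
apply: (eisenstein_crit p_pr); rewrite ?size_iter.
- by rewrite eqSS gtn_eqF.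
- have /monicP -> : iter_poly phi n.+1 \is monic.
    by rewrite iter_poly_monic ?phi_pk_monic // size_phi_pk ltnS ltnW.
  by rewrite dvdz1 gtn_eqF.
- rewrite -horner_coef0 iter_polyE horner_poly_iter -[phi]map_phi_pk_int.
  by rewrite iter_phi_pk0 dvdzE abszN natz expr2 dvdn_pmul2r ?prime_gt0.
- move=> i lt_i; rewrite (dvdz_pcharf (pchar_Fp p_pr)).
  by have /polyP/(_ i) := map_iter n.+1; rewrite coef_map coefXn ltn_eqF // => ->.
Qed.

Section CriticalOrbitReduction.
Variables (K : idomainType) (n : nat).

Local Notation phiK := (map_poly (intr : int -> K) phi).
Local Notation critK := (crit%:~R : K).

Hypotheses (kp_neq0 : (k * p)%:R != 0 :> K)
  (crit_root : iter n.+1 (horner phiK) critK = 0).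

Let p_neq0 : p%:R != 0 :> K.
Proof. by apply: contra_neq kp_neq0; rewrite natrM => ->; rewrite mulr0. Qed.

Lemma iter_phi_pk0_neq0 j : iter j.+1 (horner phiK) 0 != 0.
Proof. by rewrite iter_phi_pk0 oppr_eq0. Qed.

Lemma root_deriv_phi_pk z : root phiK^`() z -> z != critK -> z = 0.
Proof.
rewrite rootE horner_deriv_phi_pk !mulf_eq0 subr_eq0 (negPf p_neq0) => /orP[|/eqP->].
  by rewrite expf_eq0 => /andP[_ /eqP].
by rewrite eqxx.
Qed.

Lemma iter_other_crit_neq0 z j : root phiK^`() z -> z != critK -> (0 < j <= n.+1)%N ->
  iter j (horner phiK) z != 0.
Proof. by case: j => // j /root_deriv_phi_pk zc /zc -> _; apply: iter_phi_pk0_neq0. Qed.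

Lemma iter_crit_neq0 j : (0 < j <= n)%N -> iter j (horner phiK) critK != 0.
Proof.
move=> /andP[_ le_jn]; apply/eqP => fj0; have /eqP[] := iter_phi_pk0_neq0 (n - j).
by rewrite -[0 in LHS]fj0 -iterD addSn subnK.
Qed.

Lemma root_deriv_crit : root phiK^`() critK.
Proof. by rewrite rootE horner_deriv_phi_pk subrr mulr0. Qed.

Lemma nonroot_deriv2_crit : ~~ root phiK^`(2) critK.
Proof.
rewrite rootE derivnS derivn1 deriv_phi_pk derivM derivC mul0r add0r derivM derivXsubC.
rewrite mulr1.
rewrite hornerM hornerC hornerD hornerM hornerXsubC subrr mulr0 add0r hornerXn.
rewrite mulf_neq0 // expf_neq0 //.
by apply: contraNneq (iter_phi_pk0_neq0 n) => c0; rewrite -{1}c0 crit_root.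
Qed.

End CriticalOrbitReduction.

Lemma prod_deriv_iter_phi_pk (n q : nat) (rs : seq algInt) :
  prime q -> ~~ (q %| k * p)%N -> odd (logn q `|iter n.+1 (horner phi) crit|) ->
  poly_iter (map_poly intr phi) n.+1 = \prod_(r <- rs) ('X - r%:P) ->
  exists2 m : int, \prod_(r <- rs) (map_poly intr phi)^`().[r] = m%:~R & odd (logn q `|m|).
Proof.
move=> q_pr q_ndvd_kp q_odd Drs.
exists (((-1) ^+ p.-1 * p%:R) ^+ size rs * (- (k * p)%:R) ^+ p.-2 *
        iter n.+1 (horner phi) crit).
  rewrite prod_deriv_phi_pk -Drs !horner_poly_iter iter_phi_pk0.
  by rewrite -rmorph_iter_horner !(rmorphM, rmorphXn, rmorphN, rmorph1, rmorph_nat).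
have q_ndvd_p : ~~ (q %| p)%N by apply: contra q_ndvd_kp; apply: dvdn_mull.
rewrite abszM logn_Gauss // prime_coprime // !(abszM, abszX, abszN) !natz !absz_nat.
rewrite exp1n mul1n Euclid_dvdM // !Euclid_dvdX // negb_or.
by rewrite (negPf q_ndvd_p) (negPf q_ndvd_kp).
Qed.

Lemma gal_transposition_phi_pk (n q : nat) :
  prime p -> ~~ (p %| k)%N -> prime q -> ~~ (q %| k * p)%N ->
  odd (logn q `|iter n.+1 (horner phi) crit|) -> has_gal_transposition (level phi n.+1).
Proof.
move=> p_pr p_ndvd_k q_pr q_ndvd_kp q_odd.
have [K [red q_pchar]] := algInt_residue_field q_pr.
have kp_neq0 : (k * p)%:R != 0 :> K by rewrite -(dvdn_pcharf q_pchar).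
have crit_root : iter n.+1 (horner (map_poly intr phi)) crit%:~R = 0 :> K.
  rewrite -rmorph_iter_horner; apply/eqP.
  by rewrite -(dvdz_pcharf q_pchar) dvdzE odd_logn_dvd.
apply: (gal_transposition_of_critical_orbit red (c := crit%:~R) _ _ _ q_pchar).
- exact: phi_pk_monic.
- by rewrite size_phi_pk ltnS ltnW.
- exact: irreducible_iter_phi_pk.
- exact: root_deriv_crit.
- exact: nonroot_deriv2_crit crit_root.
- by rewrite rootE horner_poly_iter crit_root.
- exact: iter_other_crit_neq0.
- exact: iter_crit_neq0.
- by move=> rs; apply: prod_deriv_iter_phi_pk.
Qed.

Lemma full_arboreal_phi_pk : prime p -> ~~ (p %| k)%N ->
  (forall n, exists q : nat, [/\ prime q, ~~ (q %| k * p)%N &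
    odd (logn q `|iter n.+1 (horner phi) crit|)]) ->
  full_arboreal phi.
Proof.
move=> p_pr p_ndvd_k odd_primes.
apply: (full_arboreal_of_transpositions phi_pk_monic p_pr size_phi_pk) => n.
  exact: irreducible_iter_phi_pk.
by have [q []] := odd_primes n; apply: gal_transposition_phi_pk.
Qed.

End Trinomial.

(** * The critical orbit *)

(* phi(k y) = k * rescaled_phi y, so k times the orbit of 1 - p is the critical orbit. *)
Definition rescaled_phi (p k : nat) (R : comNzRingType) (y : R) : R :=
  k%:R ^+ p.-1 * y ^+ p.-1 * (y + p%:R) - p%:R.

Definition rescaled_crit (p k n : nat) : int :=
  iter n (@rescaled_phi p k int) (- p.-1%:R).

Lemma rmorph_rescaled_phi p k (R S : comNzRingType) (h : {rmorphism R -> S}) (y : R) :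
  h (rescaled_phi p k y) = rescaled_phi p k (h y).
Proof. by rewrite /rescaled_phi rmorphB !rmorphM /= !rmorphXn rmorphD /= !rmorph_nat. Qed.

Lemma iter_crit_rescaled p k n : (1 < p)%N ->
  iter n (horner (phi_pk p k)) (crit p k) = k%:R * rescaled_crit p k n.
Proof.
move=> p_gt1; elim: n => [|n IHn]; first by rewrite /= /crit natrM mulrN.
rewrite iterS IHn -map_phi_pk_int horner_phi_pk /rescaled_crit iterS /rescaled_phi.
move: (iter n _ _) => y; case: p p_gt1 {IHn} => // m _ /=.
by rewrite exprS exprMn natrM; ring.
Qed.

Lemma rescaled_phi_gt0 p k (y : int) : (0 < k)%N -> 0 < y -> 0 < rescaled_phi p k y.
Proof.
move=> k_gt0 y_gt0; rewrite subr_gt0.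
have yp_gt : p%:R < y + p%:R by rewrite ltrDr.
apply: lt_le_trans yp_gt _; apply: ler_peMl; first by rewrite addr_ge0 ?ler0n // ltW.
by rewrite mulr_ege1 // exprn_ege1 // ?ler1n // -gtz0_ge1.
Qed.

Lemma rescaled_critD_gt0 p k n m : (0 < k)%N -> 0 < rescaled_crit p k m ->
  0 < rescaled_crit p k (n + m).
Proof. by move=> k_gt0 m_gt0; elim: n => // n; apply: rescaled_phi_gt0. Qed.

Lemma rescaled_critS_gt0 p k n : odd p -> (2 < p)%N -> (0 < k)%N ->
  0 < rescaled_crit p k n.+1.
Proof.
move=> p_odd p_gt2 k_gt0; rewrite -addn1; apply: rescaled_critD_gt0 => //.
case: p p_odd p_gt2 => // m /= m_even m_gt1.
rewrite /rescaled_crit /= /rescaled_phi /= subr_gt0 -[X in _ + X]natr1 addKr mulr1.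
rewrite exprNn -signr_odd (negPf m_even) mul1r -!natrX -natrM ltr_nat.
have k1 : (1 <= k ^ m)%N by rewrite expn_gt0 k_gt0.
apply: leq_trans (leq_mul k1 (leqnn _)); rewrite mul1n.
apply: (@leq_trans (m ^ 2)); last by rewrite leq_pexp2l // ltnW.
by rewrite -mulnn; nia.
Qed.

Lemma rescaled_critD_residue p k (R : comNzRingType) (a : R) n m :
  (rescaled_crit p k m)%:~R = a -> rescaled_phi p k a = a ->
  (rescaled_crit p k (n + m))%:~R = a.
Proof.
move=> m_a fix_a; elim: n => // n IHn.
by rewrite /rescaled_crit iterS rmorph_rescaled_phi /= -/(rescaled_crit p k (n + m)) IHn.
Qed.

Lemma nonsquare_of_residue (R : comNzRingType) (A : int) (m : nat) :
  0 < A -> (forall x : R, x ^+ 2 != A%:~R) -> `|A|%N <> (m ^ 2)%N.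
Proof.
move=> A_gt0 nsq Am; have /eqP[] := nsq m%:R.
by rewrite -natrX -Am -[in RHS](gtz0_abs A_gt0).
Qed.

Lemma nonsquare_odd_logn (a : nat) : (forall m, a <> (m ^ 2)%N) ->
  exists2 q, prime q & odd (logn q a).
Proof.
move=> nsq; apply: contrapT => no_q.
have a_gt0 : (0 < a)%N by rewrite lt0n; apply/eqP => a0; apply: (nsq 0%N); rewrite a0.
apply: (nsq (\prod_(q <- primes a) q ^ (logn q a)./2)%N).
rewrite [LHS]prod_prime_decomp // prime_decompE big_map /= -mulnn -big_split /=.
rewrite big_seq [RHS]big_seq; apply: eq_bigr => q; rewrite mem_primes => /and3P[q_pr _ _].
rewrite -expnD addnn halfK; case odd_q: (odd _); last by rewrite subn0.
by case: no_q; exists q.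
Qed.

Section RescaledCriticalOrbit.
Variables p k : nat.
Hypotheses (p_pr : prime p) (k_gt0 : (0 < k)%N) (p_ndvd_k : ~~ (p %| k)%N).

Lemma rescaled_crit_ndvd n : ~~ (p%:Z %| rescaled_crit p k n)%Z.
Proof.
rewrite (dvdz_pcharf (pchar_Fp p_pr)).
have p0 : p%:R = 0 :> 'F_p := pcharf0 (pchar_Fp p_pr).
have k_neq0 : k%:R != 0 :> 'F_p by rewrite -(dvdn_pcharf (pchar_Fp p_pr)).
elim: n => [|n IHn].
  rewrite rmorphN rmorph_nat oppr_eq0 -(dvdn_pcharf (pchar_Fp p_pr)).
  by rewrite gtnNdvd //; have := prime_gt1 p_pr; lia.
rewrite /rescaled_crit iterS rmorph_rescaled_phi /= /rescaled_phi p0 addr0 subr0.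
by rewrite !mulf_neq0 ?expf_neq0.
Qed.

Lemma coprime_rescaled_crit q n : prime q -> (q%:Z %| rescaled_crit p k n.+1)%Z ->
  ~~ (q %| k * p)%N.
Proof.
move=> q_pr q_dvd; rewrite Euclid_dvdM // negb_or.
have q_ndvd_p : ~~ (q %| p)%N.
  rewrite dvdn_prime2 //; apply: contraTneq q_dvd => ->; exact: rescaled_crit_ndvd.
rewrite q_ndvd_p andbT; apply: contra q_ndvd_p; move: q_dvd.
rewrite (dvdz_pcharf (pchar_Fp q_pr)) !(dvdn_pcharf (pchar_Fp q_pr)).
rewrite /rescaled_crit iterS rmorph_rescaled_phi /= /rescaled_phi => crit0 /eqP k0.
move: crit0; rewrite k0 expr0n; case: p p_pr (prime_gt1 p_pr) => [|[|m]] //= _ _.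
by rewrite !mul0r sub0r oppr_eq0.
Qed.

Lemma full_arboreal_of_nonsquare :
  (forall n m, `|rescaled_crit p k n.+1|%N <> (m ^ 2)%N) -> full_arboreal (phi_pk p k).
Proof.
move=> nsq; have p_gt1 := prime_gt1 p_pr.
apply: (full_arboreal_phi_pk p_gt1) => // n.
have [q q_pr q_odd] := nonsquare_odd_logn (nsq n).
have q_ndvd : ~~ (q %| k * p)%N.
  by apply: (coprime_rescaled_crit (n := n)) => //; rewrite dvdzE odd_logn_dvd.
exists q; split=> //; rewrite iter_crit_rescaled // abszM natz absz_nat.
rewrite logn_Gauss // prime_coprime //.
by apply: contra q_ndvd; apply: dvdn_mulr.
Qed.

End RescaledCriticalOrbit.

Lemma F3_neq0 (x : 'F_3) : x != 0 -> x = 1 \/ x = -1.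
Proof. by case: x => -[|[|[|]]] // lt3 _; [left | right]; apply/eqP. Qed.

Lemma rescaled_crit_mod3 p k n : (1 < p)%N -> odd p -> ~~ (3 %| p)%N -> (k %% 3)%N = 1%N ->
  (rescaled_crit p k n.+1)%:~R = -1 :> 'F_3.
Proof.
move=> p_gt1 p_odd p_ndvd3 k1; have p_gt0 := odd_gt0 p_odd.
have k_eq1 : k%:R = 1 :> 'F_3 by apply: val_inj; rewrite /= val_Fp_nat // k1.
have pow_p1 (x : 'F_3) : x != 0 -> x ^+ p.-1 = 1.
  have even_p1 : ~~ odd p.-1 by move: p_odd; rewrite -[in odd p](prednK p_gt0).
  by case/F3_neq0=> ->; rewrite ?expr1n // -signr_odd (negPf even_p1).
rewrite -[n.+1]addn1; apply: rescaled_critD_residue; last first.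
  by rewrite /rescaled_phi k_eq1 expr1n pow_p1 //; ring.
rewrite /rescaled_crit /= rmorph_rescaled_phi rmorphN rmorph_nat /= /rescaled_phi.
have -> : p.-1%:R = p%:R - 1 :> 'F_3 by rewrite -subn1 natrB.
have /F3_neq0 : p%:R != 0 :> 'F_3 by rewrite -(dvdn_pcharf (pchar_Fp (isT : prime 3))).
rewrite k_eq1 expr1n => -[] ->; last by rewrite pow_p1 //; apply/eqP.
have p1_neq0 : (p.-1 == 0)%N = false by apply/eqP; lia.
by rewrite subrr oppr0 expr0n p1_neq0 mulr0 mul0r sub0r.
Qed.

Lemma full_arboreal_mod3 p k : prime p -> (5 <= p)%N -> (0 < k)%N -> ~~ (p %| k)%N ->
  (k %% 3)%N = 1%N -> full_arboreal (phi_pk p k).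
Proof.
move=> p_pr p_ge5 k_gt0 p_ndvd_k k1; apply: full_arboreal_of_nonsquare => // n m.
have p_gt2 : (2 < p)%N by rewrite ltnW // ltnW.
have p_odd : odd p by have [p2|//] := even_prime p_pr; rewrite p2 in p_gt2.
have p_ndvd3 : ~~ (3 %| p)%N by rewrite dvdn_prime2 // ltn_eqF // ltnW.
apply: (@nonsquare_of_residue 'F_3) => [|x]; first exact: rescaled_critS_gt0.
by rewrite rescaled_crit_mod3 ?prime_gt1 //; case: x => -[|[|[|]]].
Qed.

Lemma full_arboreal_3_2 : full_arboreal (phi_pk 3 2).
Proof.
apply: full_arboreal_of_nonsquare => // n m.
have crit_res : (rescaled_crit 3 2 n.+1)%:~R = 5%:R :> 'Z_8.
  by rewrite -[n.+1]addn1; apply: rescaled_critD_residue; apply: val_inj.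
apply: (@nonsquare_of_residue 'Z_8) => [|x]; first exact: rescaled_critS_gt0.
by rewrite crit_res; case: x => -[|[|[|[|[|[|[|[|]]]]]]]].
Qed.

Lemma full_arboreal_2_3 : full_arboreal (phi_pk 2 3).
Proof.
apply: full_arboreal_of_nonsquare => // -[|n] m.
  by change (5%N <> (m ^ 2)%N); rewrite -mulnn; case: m => [|[|[|m]]] //; lia.
have crit_res : (rescaled_crit 2 3 n.+2)%:~R = 3%:R :> 'Z_4.
  by rewrite -[n.+2]addn2; apply: rescaled_critD_residue; apply: val_inj.
apply: (@nonsquare_of_residue 'Z_4) => [|x].
  by rewrite -[n.+2]addn2 rescaled_critD_gt0.
by rewrite crit_res; case: x => -[|[|[|[|]]]].
Qed.

Lemma full_arboreal_prime_degree l : prime l -> exists k, full_arboreal (phi_pk l k).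
Proof.
move=> l_pr; have [l_ge5|] := leqP 5 l.
  by exists 1%N; apply: full_arboreal_mod3; rewrite // dvdn1 gtn_eqF // prime_gt1.
case: l l_pr => [|[|[|[|[|l]]]]] // _ _; first by exists 3%N; exact: full_arboreal_2_3.
by exists 2%N; exact: full_arboreal_3_2.
Qed.

Local Close Scope ring_scope.

Theorem theorem1p2 :
  (forall p k : nat, prime p -> (5 <= p)%N -> (0 < k)%N -> ~~ (p %| k)%N ->
     k %% 3 = 1%N -> full_arboreal (phi_pk p k)) /\
  full_arboreal (phi_pk 3 2) /\
  (forall l : nat, prime l ->
     exists phi : {poly int}, size phi = l.+1 /\ full_arboreal phi).
Proof.
split; first exact: full_arboreal_mod3.
split; first exact: full_arboreal_3_2.
move=> l l_pr; have [k full_k] := full_arboreal_prime_degree l_pr.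
by exists (phi_pk l k); rewrite size_phi_pk ?prime_gt1.
Qed.
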